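(* For each $r\in\mathfrak{P}$, the flat $3$-torus $\mathbb{T}^3_r$ admits a $13$-parameter family of pairwise non-congruent minimal isometric immersions into spheres, and, apart from a $7$-dimensional subset, every minimal immersion of $\mathbb{T}^3_r$ in this family is non-homogeneous.
   Context: $\mathfrak{P}$ is the set of prime numbers congruent to $1$ modulo $4$. For $r\in\mathfrak{P}$, let $\Lambda_{3,r}^*\subset\mathbb{R}^3$ be the lattice generated by $$\eta_1=\Big(\tfrac{2}{\sqrt3},0,0\Big)^t,\quad \eta_2=\sqrt{\tfrac23}\Big(-\tfrac1{\sqrt2},\tfrac1r,0\Big)^t,\quad \eta_3=\sqrt{\tfrac23}\Big(-\tfrac1{\sqrt2},0,\tfrac1r\Big)^t,$$ and let $\Lambda_{3,r}=\{v\in\mathbb{R}^3:\langle v,\xi\rangle\in\mathbb{Z}\ \forall \xi\in\Lambda_{3,r}^*\}$ be its dual lattice. $\mathbb{T}^3_r=\mathbb{R}^3/\Lambda_{3,r}$ is equipped with the metric $\frac{4\pi^2}{3}(du_1^2+du_2^2+du_3^2)$ (so norm-one vectors of $\Lambda^*_{3,r}$ correspond to the Laplace eigenvalue $3$). Spheres are unit round spheres. A $13$-parameter family means a family depending continuously on a parameter ranging in a set $P\subset\mathbb{R}^{13}$ with nonempty interior; the exceptional subset is a subset of $P$ of dimension $7$. Two immersions into a common sphere $\mathbb{S}^m$ are congruent if $x'=R\circ x$ for some $R\in O(m+1)$ (spheres of different dimension being regarded as great spheres of a common one). Homogeneity: let $\pm\xi_1,\dots,\pm\xi_N$ be all vectors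 of length $1$ in $\Lambda_{3,r}^*$, $\theta_j=2\pi\langle\xi_j,u\rangle$, $\Theta_j=(\cos\theta_j,\sin\theta_j)$. Every minimal isometric immersion $x:\mathbb{T}^3_r\to\mathbb{S}^m$ has the form $x=(\Theta_1,\dots,\Theta_N)A$ for a unique real $2N\times(m+1)$ matrix $A$; $x$ is homogeneous if and only if $AA^t$ is diagonal. *)

(* Defs.v *)
From HB Require Import structures.
From mathcomp Require Export all_boot all_order all_algebra.
From mathcomp Require Export all_classical all_reals all_analysis.
Export Order.TTheory GRing.Theory Num.Theory.
Export numFieldNormedType.Exports.

Set Implicit Arguments.
Unset Strict Implicit.
Unset Printing Implicit Defensive.

Local Open Scope classical_set_scope.
Local Open Scope ring_scope.

Definition dot (R : realType) (n : nat) (u v : 'rV[R]_n) : R :=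
  \sum_(i < n) u 0 i * v 0 i.

Definition vec3 (R : realType) (a b c : R) : 'rV[R]_3 :=
  \row_(j < 3) [:: a; b; c]`_j.

Definition eta1 (R : realType) : 'rV[R]_3 :=
  vec3 (2 / Num.sqrt 3) 0 0.

Definition eta2 (R : realType) (r : nat) : 'rV[R]_3 :=
  Num.sqrt (2 / 3) *: vec3 (- (1 / Num.sqrt 2)) (1 / r%:R) 0.

Definition eta3 (R : realType) (r : nat) : 'rV[R]_3 :=
  Num.sqrt (2 / 3) *: vec3 (- (1 / Num.sqrt 2)) 0 (1 / r%:R).

Definition lattice_star (R : realType) (r : nat) : set 'rV[R]_3 :=
  [set xi | exists a b c : int,
     xi = a%:~R *: eta1 R + b%:~R *: eta2 R r + c%:~R *: eta3 R r].

Definition dual_lattice (R : realType) (n : nat) (L : set 'rV[R]_n) :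
    set 'rV[R]_n :=
  [set v | forall xi, L xi -> dot v xi \is a Num.int].

Section Immersions.
Variables (R : realType) (n m : nat).
Implicit Type f : 'rV[R]_n.+1 -> 'rV[R]_m.+1.

Definition partial f (i : 'I_n.+1) : 'rV[R]_n.+1 -> 'rV[R]_m.+1 :=
  'D_(delta_mx 0 i) f.

(* C^oo: every iterated directional derivative of f is differentiable
   (in particular continuous) everywhere. *)
Definition smooth f : Prop :=
  forall (vs : seq 'rV[R]_n.+1) (u : 'rV[R]_n.+1),
    differentiable (foldr (fun v g => 'D_v g) f vs) u.

(* A map defined on the torus R^n / L is a map on R^n that is L-periodic. *)
Definition periodic_for (L : set 'rV[R]_n.+1) f : Prop :=
  forall u v, L v -> f (u + v) = f u.

Definition in_unit_sphere f : Prop := forall u, dot (f u) (f u) = 1.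

Definition first_form f (u : 'rV[R]_n.+1) : 'M[R]_n.+1 :=
  \matrix_(i, j) dot (partial f i u) (partial f j u).

(* The induced metric is c (du_1^2 + ... + du_n^2); for c != 0 such an f is
   an immersion. *)
Definition isometric_for (c : R) f : Prop := forall u, first_form f u = c%:M.

(* nu is a normal vector at f u of f, viewed as an immersion into the unit
   sphere: tangent to the sphere and orthogonal to the image of df. *)
Definition normal_at f (u : 'rV[R]_n.+1) (nu : 'rV[R]_m.+1) : Prop :=
  dot nu (f u) = 0 /\ forall i, dot nu (partial f i u) = 0.

(* Second fundamental form in the sphere, in the normal direction nu. *)
Definition second_form f (u : 'rV[R]_n.+1) (nu : 'rV[R]_m.+1) : 'M[R]_n.+1 :=
  \matrix_(i, j) dot (partial (partial f j) i u) nu.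

(* The mean curvature vector of f in the sphere vanishes: the trace, with
   respect to the induced metric, of the second fundamental form is zero in
   every normal direction. *)
Definition minimal_in_sphere f : Prop :=
  forall u nu, normal_at f u nu ->
    \sum_i \sum_j invmx (first_form f u) i j * second_form f u nu i j = 0.

Definition minimal_isometric_immersion (L : set 'rV[R]_n.+1) (c : R) f : Prop :=
  [/\ smooth f, periodic_for L f, in_unit_sphere f, isometric_for c f
    & minimal_in_sphere f].

Definition congruent f g : Prop :=
  exists Q : 'M[R]_m.+1, Q *m Q^T = 1%:M /\ forall u, g u = f u *m Q.

End Immersions.

Section Homogeneity.
Variables (R : realType) (n m : nat).

(* +-xi_1, ..., +-xi_N are all the vectors of length 1 of L, one xi_j being
   chosen in each pair. *)
Definition unit_vectors_up_to_sign (L : set 'rV[R]_n.+1) (N : nat)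
    (xi : 'I_N -> 'rV[R]_n.+1) : Prop :=
  (forall v, (L v /\ dot v v = 1) <-> (exists j, v = xi j \/ v = - xi j)) /\
  (forall i j, xi i = xi j \/ xi i = - xi j -> i = j).

(* The row vector (Theta_1, ..., Theta_N), Theta_j = (cos theta_j, sin theta_j),
   with theta_j = 2 pi <xi_j, u>; mxvec concatenates the rows Theta_j. *)
Definition Theta (N : nat) (xi : 'I_N -> 'rV[R]_n.+1) (u : 'rV[R]_n.+1) :
    'rV[R]_(N * 2) :=
  mxvec (\matrix_(j < N, b < 2)
    let theta := 2 * pi * dot (xi j) u in
    if b == 0 then cos theta else sin theta).

(* Diagonality of A A^T does not depend on the numbering of the xi_j nor on
   the choice of signs, and A is unique, so that the existential quantifiers
   on xi and A are harmless. *)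
Definition homogeneous (Lstar : set 'rV[R]_n.+1)
    (f : 'rV[R]_n.+1 -> 'rV[R]_m.+1) : Prop :=
  exists (N : nat) (xi : 'I_N -> 'rV[R]_n.+1) (A : 'M[R]_(N * 2, m.+1)),
    [/\ unit_vectors_up_to_sign Lstar xi,
        (forall u, f u = Theta xi u *m A)
      & is_diag_mx (A *m A^T)].

End Homogeneity.

(* Hausdorff dimension. On 'rV[R]_n the norm `|_| is the sup norm; being
   equivalent to the Euclidean one, it gives the same dimension. *)
Section Hausdorff.
Variables (R : realType) (V : normedModType R).
Local Open Scope ereal_scope.

(* 0 is thrown in to get diam set0 = 0. *)
Definition diam (U : set V) : \bar R :=
  ereal_sup [set t | t = 0 \/ exists x y, [/\ U x, U y & t = `|x - y|%R%:E]].

Definition hausdorff_premeasure (d delta : R) (E : set V) : \bar R :=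
  ereal_inf [set s | exists U : (set V)^nat,
    [/\ E `<=` \bigcup_i U i, forall i, diam (U i) <= delta%:E
      & s = \sum_(0 <= i <oo) diam (U i) `^ d]].

Definition hausdorff_measure (d : R) (E : set V) : \bar R :=
  ereal_sup [set hausdorff_premeasure d delta E | delta in [set t | (0 < t)%R]].

Definition hausdorff_dim (E : set V) : \bar R :=
  ereal_inf [set d%:E | d in [set d | (0 < d)%R /\ hausdorff_measure d E = 0]].

End Hausdorff.

(* Main.v *)
From HB Require Import structures.
Require Import Defs.
From mathcomp Require Import finfield measurable_realfun ring lra zify.

(** A map u |-> sum_j cos(theta_j) a_j + sin(theta_j) b_j is determined, up to
    congruence, by the Gram matrix of its coefficients. The vectors of length one
    of the lattice are +-xi for the twelve xi = (1/sqrt 3, sqrt(2/3) w) with w in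
    (1/r)Z^2 on the unit circle; they come in six pairs {w, -w}. The sums
    xi_w + xi_(-w) are the same for the six pairs, and this is the only
    coincidence among sums of unit vectors that leaves room for off-diagonal
    entries: the weights |a_j|^2 = |b_j|^2 satisfy five linear equations and have
    7 degrees of freedom, while the correlations between xi_w and xi_(-w) (two
    real numbers for each pair) satisfy six and have 6. Near the uniform weights
    every such Gram matrix is positive, and it is diagonal exactly when the last
    six parameters vanish. *)

Set Implicit Arguments.
Unset Strict Implicit.
Unset Printing Implicit Defensive.

Local Open Scope classical_set_scope.
Local Open Scope ring_scope.

(** * Sums of two squares *)

(** The correlation block of a pair is the traceless symmetric matrix (P, Q; Q, -P). This shape
    removes the frequency xi_w - xi_(-w), which varies with w, and leaves 2 P cos + 2 Q sin of the
    common phase. The sphere and isometry conditions then only involve moments of P and Q of orders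
    zero and two on the circle: order one cancels because the planar parts of xi_w and xi_(-w) are
    opposite. This gives three equations for P and three for Q. For the weights, order one
    constrains the differences inside pairs, and orders zero and two the sums. The list of twelve
    vectors is arithmetic: r = 1 mod 4 yields a representation of r^2 off the axes, and primality
    excludes any further one. Congruence and homogeneity quantify over arbitrary matrices; linear
    independence of the functions cos theta_j, sin theta_j reduces both to Gram entries. These are
    affine in the parameters, so the homogeneous ones form a coordinate slice of a cube, whose
    Hausdorff dimension is computed directly. *)

Lemma sqrtm1_Fp (p : nat) : prime p -> p = 1 %[mod 4] ->
  exists x : 'F_p, x ^+ 2 = -1.
Proof.
move=> pp p1.
have p2 : (2 < p)%N by have := prime_gt1 pp; move: p1; case: p pp => [|[|[|[|]]]].
have [k kE] : exists k, p = (4 * k + 1)%N.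
  by exists (p %/ 4)%N; rewrite {1}(divn_eq p 4) p1 mulnC.
have cardF : #|'F_p| = p by rewrite card_Fp.
have k0 : (0 < k)%N by lia.
(* With p = 4k + 1, X^(2k) - 1 has at most 2k roots among 4k nonzero elements. A nonzero non-root y
   has y^(4k) = 1, hence y^(2k) = -1, and y^k is the square root sought. *)
have [y yU] : exists y : 'F_p, (y != 0) && (y ^+ (2 * k) != 1).
  apply: contrapT => H0.
  have H z : z != 0 -> z ^+ (2 * k) = 1 :> 'F_p.
    by move=> z0; apply/eqP; apply: contrapT => /negP z1; apply: H0; exists z; rewrite z0.
  pose q : {poly 'F_p} := 'X^(2 * k) - 1.
  have qs : size q = (2 * k).+1 by rewrite size_XnsubC//; lia.
  have := @max_poly_roots _ q (enum [pred y : 'F_p | y != 0]).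
  rewrite -size_poly_eq0 qs => /(_ isT) => /(_ _ (enum_uniq _)).
  rewrite -cardE.
  have -> : #|[pred y : 'F_p | y != 0]| = p.-1.
    by have := cardC1 (0 : 'F_p); rewrite cardF => <-; apply: eq_card.
  move=> /(_ _); suff h : all (root q) (enum [pred y : 'F_p | y != 0]).
    by move=> /(_ h); lia.
  apply/allP => z; rewrite mem_enum inE => z0; rewrite rootE !hornerE.
  by rewrite H// subrr.
move: yU => /andP[y0 y1].
have y4 : y ^+ (4 * k) = 1.
  have := expf_card y; have -> : #|'F_p| = (4 * k).+1 by rewrite cardF kE addn1.
  rewrite exprSr => /eqP.
  rewrite -subr_eq0 -{3}[y]mul1r -mulrBl mulf_eq0 subr_eq0 (negbTE y0) orbF.
  by move/eqP.
exists (y ^+ k).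
have : (y ^+ (2 * k) - 1) * (y ^+ (2 * k) + 1) = 0.
  by rewrite -subr_sqr -exprM -mulnA [(k*2)%N]mulnC mulnA y4 expr1n subrr.
move/eqP; rewrite mulf_eq0 subr_eq0 (negbTE y1) /= addr_eq0 => /eqP <-.
by rewrite -exprM mulnC.
Qed.

Lemma nat_sqrt (n : nat) : exists k, (k * k <= n < k.+1 * k.+1)%N.
Proof.
elim: n => [|n [k /andP[k1 k2]]]; first by exists 0%N.
have [h|h] := ltnP n.+1 (k.+1 * k.+1); first by exists k; lia.
by exists k.+1; nia.
Qed.

Lemma intr_Fp_eq0 (p : nat) (z : int) : prime p ->
  (z%:~R == 0 :> 'F_p) = (p %| z)%Z.
Proof.
move=> pp; have cF := @pchar_Fp p pp.
case: z => n; rewrite ?NegzE; rewrite ?dvdzN ?rmorphN ?oppr_eq0;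
  exact: (esym (dvdn_pcharf cF _)).
Qed.

(** Thue's argument: there are (k+1)^2 > p pairs with entries at most k, so x u1 - u2 takes some
    value of F_p twice. The differences satisfy b = x a modulo p, so p divides a^2 + b^2, which lies
    strictly between 0 and 2p. *)
Lemma fermat_two_squares (p : nat) : prime p -> p = 1 %[mod 4] ->
  exists a b : int, a ^+ 2 + b ^+ 2 = p%:Z.
Proof.
move=> pp p1; have [x xE] := sqrtm1_Fp pp p1.
have [k /andP[k1 k2]] := nat_sqrt p.
pose F (u : 'I_k.+1 * 'I_k.+1) : 'F_p := x * (u.1 : nat)%:R - (u.2 : nat)%:R.
have : ~~ injectiveb F.
  apply/negP => /injectiveP /leq_card.
  by rewrite card_Fp// card_prod !card_ord; lia.
case/injectivePn => -[u1 u2] [[v1 v2] uv]; rewrite /F/= => Fuv.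
pose a : int := (u1 : nat)%:Z - (v1 : nat)%:Z.
pose b : int := (u2 : nat)%:Z - (v2 : nat)%:Z.
have xab : x * a%:~R = b%:~R :> 'F_p.
  rewrite /a /b !intrB -!pmulrn.
  have -> : (u2 : nat)%:R = x * (u1 : nat)%:R - (x * (v1 : nat)%:R - (v2 : nat)%:R) :> 'F_p.
    by rewrite -Fuv; ring.
  by ring.
have dvd : (p %| a ^+ 2 + b ^+ 2)%Z.
  rewrite -intr_Fp_eq0// rmorphD !rmorphXn /= -xab exprMn xE; apply/eqP; ring.
have pk : (k * k < p)%N.
  rewrite ltn_neqAle k1 andbT; apply/eqP => kp.
  have := pp; rewrite -kp => pk; have := prime_gt1 pk.
  by have [_ /(_ k)] := primeP pk; rewrite dvdn_mulr// => /(_ isT) /=; nia.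
have ab0 : 0 < a ^+ 2 + b ^+ 2.
  rewrite lt_neqAle addr_ge0 ?sqr_ge0// andbT eq_sym.
  rewrite paddr_eq0 ?sqr_ge0// !sqrf_eq0 !subr_eq0.
  apply/negP => /andP[/eqP[e1] /eqP[e2]]; move/eqP: uv; apply.
  by congr pair; apply: val_inj.
have ak : a ^+ 2 <= (k * k)%:Z.
  by have := ltn_ord u1; have := ltn_ord v1; rewrite /a; nia.
have bk : b ^+ 2 <= (k * k)%:Z.
  by have := ltn_ord u2; have := ltn_ord v2; rewrite /b; nia.
exists a, b; move/dvdzP: dvd => [q qE].
have q1 : q = 1 by nia.
by rewrite qE q1 mul1r.
Qed.

(** If a + bi has norm r, its square has norm r^2. The parts a^2 - b^2 and 2ab of the square are
    nonzero because r is odd and is not a square. *)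
Lemma pythagorean_leg (r : nat) : prime r -> r = 1 %[mod 4] ->
  exists s t : int, [/\ 0 < s, 0 < t & s ^+ 2 + t ^+ 2 = r%:Z ^+ 2].
Proof.
move=> pr r1; have [a [b ab]] := fermat_two_squares pr r1.
have nsq (c : int) : c ^+ 2 != r%:Z.
  apply/eqP => cE; have cr : (`|c| * `|c| = r)%N by lia.
  have := prime_gt1 pr.
  have [_ /(_ `|c|%N)] := primeP pr; rewrite -[X in (_ %| X)%N]cr dvdn_mulr//.
  by move=> /(_ isT) /=; nia.
have rodd : odd r by have /(congr1 odd) := divn_eq r 4; lia.
exists `|a ^+ 2 - b ^+ 2|, `|2 * a * b|; split.
- rewrite normr_gt0 subr_eq0; apply/eqP => e.
  have : r%:Z = 2 * b ^+ 2 by rewrite -ab e; ring.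
  lia.
- rewrite normr_gt0 !mulf_neq0//.
    by apply/eqP => a0; have := nsq b; rewrite -ab a0 expr0n add0r eqxx.
  by apply/eqP => b0; have := nsq a; rewrite -ab b0 expr0n addr0 eqxx.
- by rewrite !real_normK ?num_real// -ab; ring.
Qed.

(* r^2 divides (bs - ct)(bs + ct); since r cannot divide both factors, it divides
   one of them, which is bounded by r^2 in absolute value. *)
Lemma sum_two_squares_prime_sqr (r : nat) (s t b c : int) : prime r -> odd r ->
  0 < s -> 0 < t -> s ^+ 2 + t ^+ 2 = r%:Z ^+ 2 -> b ^+ 2 + c ^+ 2 = r%:Z ^+ 2 ->
  [\/ `|b| = r%:Z /\ c = 0, b = 0 /\ `|c| = r%:Z,
      `|b| = s /\ `|c| = t | `|b| = t /\ `|c| = s].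
Proof.
move=> pr ro s0 t0 st bc.
have r0 : 0 < r%:Z by have := prime_gt0 pr; lia.
have sqr_eq (x y : int) : 0 < y -> x ^+ 2 = y ^+ 2 -> `|x| = y.
  by move=> y0 /eqP; rewrite eqf_sqr => /orP[]/eqP ->; lia.
have cancel (x y : int) : x * r%:Z ^+ 2 = y * r%:Z ^+ 2 -> x = y.
  by apply: mulIf; rewrite expf_neq0// gt_eqF.
have H1 : b ^+ 2 * s ^+ 2 = c ^+ 2 * t ^+ 2 -> `|b| = t /\ `|c| = s.
  move=> e; have bt : b ^+ 2 = t ^+ 2.
    by apply: cancel; rewrite -{1}st -bc !mulrDr e; ring.
  by split; apply: sqr_eq => //; lia.
have H2 : b ^+ 2 * t ^+ 2 = c ^+ 2 * s ^+ 2 -> `|b| = s /\ `|c| = t.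
  move=> e; have bs : b ^+ 2 = s ^+ 2.
    by apply: cancel; rewrite -{1}st -bc !mulrDr e; ring.
  by split; apply: sqr_eq => //; lia.
(* Applied to the two forms of the Brahmagupta identity, (bs + ct)^2 + (bt - cs)^2 = r^4 = (bs -
   ct)^2 + (bt + cs)^2: a nonzero multiple of r^2 already exhausts r^4. *)
have key (p e : int) : (r%:Z ^+ 2 %| p)%Z -> p ^+ 2 + e ^+ 2 = r%:Z ^+ 4 ->
    p = 0 \/ e = 0.
  move=> /dvdzP[m ->] pe; have [->|m0] := eqVneq m 0; first by left; rewrite mul0r.
  right; apply/eqP; rewrite -sqrf_eq0 eq_le sqr_ge0 andbT.
  have m1 : 1 <= m ^+ 2 by rewrite -gtz0_ge1 lt_neqAle sqr_ge0 eq_sym sqrf_eq0 m0.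
  have : r%:Z ^+ 4 * 1 <= r%:Z ^+ 4 * m ^+ 2 by rewrite ler_wpM2l// exprn_ge0// ltW.
  have -> : r%:Z ^+ 4 * m ^+ 2 = r%:Z ^+ 4 - e ^+ 2.
    by rewrite -{2}pe addrK; move: (r%:Z) => z; ring.
  by rewrite mulr1 lerDl oppr_ge0.
have pq : (b * s - c * t) * (b * s + c * t) = (b ^+ 2 + s ^+ 2 - r%:Z ^+ 2) * r%:Z ^+ 2.
  have -> : (b * s - c * t) * (b * s + c * t) = b ^+ 2 * s ^+ 2 - c ^+ 2 * t ^+ 2 by ring.
  have -> : c ^+ 2 = r%:Z ^+ 2 - b ^+ 2 by rewrite -bc; ring.
  have -> : t ^+ 2 = r%:Z ^+ 2 - s ^+ 2 by rewrite -st; ring.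
  by ring.
have r4 : r%:Z ^+ 4 = (b ^+ 2 + c ^+ 2) * (s ^+ 2 + t ^+ 2) by rewrite bc st -exprD.
have dvd_pq : (r%:Z ^+ 2 %| (b * s - c * t) * (b * s + c * t))%Z.
  by rewrite pq dvdz_mull.
have coprime_r (z : int) : ~~ (r %| z)%Z -> coprimez (r%:Z ^+ 2) z.
  by move=> rz; rewrite coprimezXl// coprimezE prime_coprime.
have [rp|rp] := boolP (r %| b * s - c * t)%Z; last first.
  move: dvd_pq; rewrite Gauss_dvdzr ?coprime_r// => /key h.
  have [|e|e] := h (b * t - c * s); first by rewrite r4; ring.
    apply: Or44; apply: H1.
    have -> : b ^+ 2 * s ^+ 2 = (b * s) ^+ 2 by ring.
    by rewrite (_ : b * s = - (c * t)); [ring | lia].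
  apply: Or43; apply: H2.
  have -> : b ^+ 2 * t ^+ 2 = (b * t) ^+ 2 by ring.
  by rewrite (_ : b * t = c * s); [ring | lia].
have [rq|rq] := boolP (r %| b * s + c * t)%Z; last first.
  move: dvd_pq; rewrite Gauss_dvdzl ?coprime_r// => /key h.
  have [|e|e] := h (b * t + c * s); first by rewrite r4; ring.
    apply: Or44; apply: H1.
    have -> : b ^+ 2 * s ^+ 2 = (b * s) ^+ 2 by ring.
    by rewrite (_ : b * s = c * t); [ring | lia].
  apply: Or43; apply: H2.
  have -> : b ^+ 2 * t ^+ 2 = (b * t) ^+ 2 by ring.
  by rewrite (_ : b * t = - (c * s)); [ring | lia].
(* Here r divides both factors, hence 2bs, hence b since r is odd and 0 < s < r. Then b is 0 or plus
   or minus r: these are the points on the axes. *)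
have rb : (r %| b)%Z.
  have dvd2 : (r %| 2 * (b * s))%Z.
    by rewrite (_ : 2 * _ = (b * s - c * t) + (b * s + c * t)); [exact: rpredD|ring].
  change (r %| `|b|)%N; have : (r %| `|(2 * (b * s))%R|)%N := dvd2.
  rewrite !abszM !Euclid_dvdM// => /or3P[||]//.
    by move=> /dvdn_leq; have := prime_gt1 pr; move: ro;
      case: (r) => [|[|[|]]]//= ? ? ? /(_ isT).
  move=> /dvdn_leq h; have rs : r%:Z <= s by rewrite -(gtz0_abs s0) lez_nat h// absz_gt0 gt_eqF.
  have t2 : 0 < t ^+ 2 by rewrite exprn_gt0.
  have : r%:Z ^+ 2 <= s ^+ 2 by rewrite ler_pXn2r// nnegrE ltW.
  by rewrite -st gerDl leNgt t2.
move/dvdzP: rb => [m bE].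
have r2 : 0 < r%:Z ^+ 2 by rewrite exprn_gt0.
have m1 : m ^+ 2 <= 1.
  by rewrite -(ler_pM2r r2) -exprMn -bE mul1r -bc lerDl sqr_ge0.
have [m0|m0] := eqVneq m 0.
  by apply: Or42; split; [rewrite bE m0 mul0r | apply: sqr_eq => //; rewrite -bc bE m0; ring].
apply: Or41; have m2 : m ^+ 2 = 1.
  by apply/eqP; rewrite eq_le m1 -gtz0_ge1 lt_neqAle sqr_ge0 eq_sym sqrf_eq0 m0.
have b2 : b ^+ 2 = r%:Z ^+ 2 by rewrite bE exprMn m2 mul1r.
split; first exact: sqr_eq.
by apply/eqP; rewrite -sqrf_eq0; move: bc; rewrite b2 => /(canRL (addKr _)) ->; rewrite addNr.
Qed.

(** * Hausdorff dimension of a flat cube *)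

Lemma ler_coord_norm (R : realType) (m n : nat) (A : 'M[R]_(m.+1, n.+1)) i j :
  `|A i j| <= `|A|.
Proof.
rewrite [leRHS]mx_normrE.
exact: (le_bigmax _ (fun ij => `|A ij.1 ij.2|) (i, j)).
Qed.

Lemma norm_le_coord (R : realType) (m n : nat) (A : 'M[R]_(m.+1, n.+1)) (e : R) :
  0 <= e -> (forall i j, `|A i j| <= e) -> `|A| <= e.
Proof.
move=> e0 Ae; rewrite [leLHS]mx_normrE.
by apply: bigmax_le => // -[i j] _; exact: Ae.
Qed.

(* The mass of a cover of [0, e]^n by boxes is at least e^n: integrating over the
   last coordinate turns a cover of [0, e]^(n.+1) into a weighted cover of
   [0, e]^n, hence the weights c. *)
Lemma cube_cover_mass (R : realType) (e : R) (n : nat) (c : nat -> R)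
    (I : nat -> nat -> set R) (L : nat -> nat -> R) :
  0 < e -> (forall i, 0 <= c i) -> (forall i k, measurable (I i k)) ->
  (forall i k, lebesgue_measure (I i k) = (L i k)%:E) ->
  (forall x : nat -> R, (forall k, (k < n)%N -> x k \in `[0, e]) ->
     (1 <= \sum_(0 <= i <oo) (c i * \prod_(k < n) \1_(I i k) (x k))%:E)%E) ->
  (1 <= \sum_(0 <= i <oo) (c i * \prod_(k < n) (L i k / e))%:E)%E.
Proof.
move=> e0; elim: n c => [|n IH] c c0 mI muI cov.
  apply: (le_trans (cov (fun=> 0) _)) => //; rewrite le_eqVlt; apply/orP; left.
  by apply/eqP; apply: eq_eseriesr => i _; rewrite !big_ord0.
have L0 i k : 0 <= L i k by rewrite -lee_fin -muI.
have Le0 i k : 0 <= L i k / e by rewrite divr_ge0// ltW.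
under eq_eseriesr do rewrite big_ord_recr /= [X in _ * X]mulrC mulrA.
apply: (IH (fun i => c i * (L i n / e))) => // [i|x xe]; first by rewrite mulr_ge0.
pose d i := c i * \prod_(k < n) \1_(I i k) (x k).
have d0 i : 0 <= d i by rewrite mulr_ge0// prodr_ge0// => k _; rewrite indicE.
(* Slicing: once x is fixed, the hypothesis says that the last sides cover the segment with weights
   [d i]. Integrating over the segment then replaces each indicator by at most [L i n]. *)
have covt t : t \in `[0, e] -> (1 <= \sum_(0 <= i <oo) (d i * \1_(I i n) t)%:E)%E.
  move=> te; have : forall k, (k < n.+1)%N ->
      (if k == n then t else x k) \in `[0, e].
    by move=> k kn; case: eqVneq => // kn'; apply: xe; lia.
  move=> /(cov (fun k => if k == n then t else x k)) /le_trans; apply; rewrite le_eqVlt;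
    apply/orP; left; apply/eqP.
  apply: eq_eseriesr => i _; rewrite big_ord_recr /= eqxx /d mulrA.
  congr (_ * _ * _)%:E; apply: eq_bigr => k _.
  by rewrite ltn_eqF.
pose D : set R := `[0, e]%classic.
have mD : measurable D by exact: measurable_itv.
have muD : lebesgue_measure D = e%:E.
  by rewrite lebesgue_measure_itv/= lte_fin e0 oppr0 adde0.
have mf i : measurable_fun D (EFin \o (fun t : R => d i * \1_(I i n) t)).
  apply/measurable_EFinP; apply: (measurable_funM (measurable_cst _)).
  by apply/measurable_funTS/measurable_indic.
have f0 i t : (0 <= (d i * \1_(I i n) t)%:E)%E by rewrite lee_fin mulr_ge0.
have : (e%:E <= \int[lebesgue_measure]_(t in D)
    \sum_(0 <= i <oo) (d i * \1_(I i n) t)%:E)%E.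
  have -> : e%:E = (\int[lebesgue_measure]_(t in D) cst 1 t)%E.
    by rewrite integral_cst// mul1e; exact: (esym muD).
  apply: ge0_le_integral => //.
  refine (@ge0_emeasurable_sum _ _ _ D (fun i (t : R) => (d i * \1_(I i n) t)%:E) xpredT _ _).
    by move=> i t _ _; exact: f0.
  by move=> i _; exact: mf.
rewrite integral_nneseries//.
have le_d i : (\int[lebesgue_measure]_(t in D) (d i * \1_(I i n) t)%:E
    <= (d i * L i n)%:E)%E.
  have mg : measurable_fun D (EFin \o (\1_(I i n) : R -> R)).
    by apply/measurable_EFinP; apply/measurable_funTS/measurable_indic.
  under eq_integral do rewrite EFinM.
  rewrite ge0_integralZl ?lee_fin//.
  rewrite (EFinM (d i)) lee_pmul ?lee_fin//; first by apply: integral_ge0 => t _;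
    rewrite lee_fin.
  rewrite integral_indic; [|exact: mD|exact: mI].
  rewrite -muI; apply: le_measure; rewrite ?inE; last exact: subIsetl.
  - exact: measurableI (mI i n) mD.
  - exact: mI.
move=> h; have {}h : (e%:E <= \sum_(0 <= i <oo) (d i * L i n)%:E)%E.
  apply: (le_trans h); apply: lee_nneseries => [i _ _|i _]; last exact: le_d.
  by apply: integral_ge0 => t _; exact: f0.
under eq_eseriesr => i _.
  rewrite (_ : _ * _ * _ = e^-1 * (d i * L i n)); last by rewrite /d; ring.
  rewrite EFinM; over.
rewrite nneseriesZl => [|i _]; last by rewrite lee_fin mulr_ge0.
have : ((e^-1)%:E * e%:E <= (e^-1)%:E * \sum_(0 <= i <oo) (d i * L i n)%:E)%E.
  by rewrite lee_pmul2l// lte_fin invr_gt0.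
by rewrite -EFinM mulVf// gt_eqF.
Qed.

(** The shape of the set of homogeneous parameters, used with n = 7 in dimension 13. *)
Definition flat_cube (R : realType) (N n : nat) (e : R) : set 'rV[R]_N.+1 :=
  [set p | (forall i, `|p 0 i| < e) /\ (forall i : 'I_N.+1, (n <= i)%N -> p 0 i = 0)].

Section Diam.
Variables (R : realType) (V : normedModType R).

Lemma diam_ge0 (U : set V) : (0 <= diam U)%E.
Proof. by apply: ereal_sup_ubound; left. Qed.

Lemma diam_ge (U : set V) x y : U x -> U y -> (`|x - y|%:E <= diam U)%E.
Proof. by move=> Ux Uy; apply: ereal_sup_ubound; right; exists x, y. Qed.

Lemma diam_le (U : set V) (h : R) : 0 <= h ->
  (forall x y, U x -> U y -> `|x - y| <= h) -> (diam U <= h%:E)%E.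
Proof.
move=> h0 Uh; apply: ge_ereal_sup => _ [->|[x [y [Ux Uy ->]]]]; rewrite lee_fin//.
exact: Uh.
Qed.

Lemma diam_set0 : diam (set0 : set V) = 0%E.
Proof. by apply/eqP; rewrite eq_le diam_ge0 andbT; apply: diam_le. Qed.

Lemma hausdorff_premeasure_ge0 (d delta : R) (E : set V) :
  (0 <= hausdorff_premeasure d delta E)%E.
Proof.
apply: le_ereal_inf_tmp => _ [U [_ _ ->]].
by apply: nneseries_ge0 => i _ _; exact: poweR_ge0.
Qed.

End Diam.

Section FlatCube.
Variables (R : realType) (N n : nat) (e : R).
Hypothesis e0 : 0 < e.

(** If d < n, a set of diameter l <= 1 has l^n <= l^d and lies in a box of side 2l. A cover with a
    small sum of l^d would thus yield boxes covering a cube with total relative volume below 1. *)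
Lemma flat_cube_dim_ge (d : R) : 0 < d -> (0 < n <= N.+1)%N ->
  hausdorff_measure d (flat_cube (N := N) n e) = 0 -> n%:R <= d.
Proof.
move=> d0 /andP[n0 nN] H0; rewrite leNgt; apply/negP => dn.
have e20 : 0 < e / 2 by rewrite divr_gt0.
(* A box of side 2l has relative volume (2l / (e/2))^n = l^n / eps in [0, e/2]^n; this closed cube
   is taken because [flat_cube] is open at e. *)
pose eps := (e / 2 / 2) ^+ n.
have eps0 : 0 < eps by rewrite exprn_gt0// divr_gt0.
have : (hausdorff_premeasure d 1 (flat_cube (N := N) n e) < eps%:E)%E.
  apply: (@le_lt_trans _ _ 0%E); last by rewrite lte_fin.
  by rewrite -H0; apply: ereal_sup_ubound; exists 1 => //=.
case/ereal_inf_lt => _ [U [Ecov U1 ->]] ltU.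
pose l i := fine (diam (U i)).
have lE i : diam (U i) = (l i)%:E.
  rewrite fineK// ge0_fin_numE ?diam_ge0//.
  by rewrite (le_lt_trans (U1 i)) ?ltry.
have l0 i : 0 <= l i by rewrite -lee_fin -lE diam_ge0.
have l1 i : l i <= 1 by rewrite -lee_fin -lE.
(* An arbitrary point when [U i] is empty; the box is then a point and covers nothing that
   matters. *)
pose a i := get (U i).
pose I i k : set R := `[a i 0 (inord k) - l i, a i 0 (inord k) + l i]%classic.
have muI i k : lebesgue_measure (I i k) = (2 * l i)%:E.
  rewrite lebesgue_measure_itv/= lte_fin; case: ltP => h.
    by rewrite -EFinB; congr EFin; ring.
  by congr EFin; have := l0 i; lra.
pose c1 (i : nat) : R := 1.
have cov (x : nat -> R) : (forall k, (k < n)%N -> x k \in `[0, e / 2]) ->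
    (1 <= \sum_(0 <= i <oo) (c1 i * \prod_(k < n) \1_(I i k) (x k))%:E)%E.
  move=> xe; pose p : 'rV[R]_N.+1 := \row_k (if (k < n)%N then x k else 0).
  have [i _ Ui] : (\bigcup_i U i) p.
    apply: Ecov; split=> k; rewrite mxE; last by rewrite ltnNge => ->.
    case: ifP => [/xe|_]; last by rewrite normr0.
    rewrite in_itv/= => /andP[x0 x1]; rewrite ger0_norm//.
    by rewrite (le_lt_trans x1)// ltr_pdivrMr// ltr_pMr// ltr1n.
  pose u j : \bar R := (c1 j * \prod_(k < n) \1_(I j k) (x k))%:E.
  have u0 j : (0 <= u j)%E.
    by rewrite lee_fin mul1r prodr_ge0// => k _; rewrite indicE.
  apply: (@le_trans _ _ (\sum_(0 <= j < i.+1) u j)%E); last first.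
    by apply: (nneseries_lim_ge (u_ := u)) => j _ _; exact: u0.
  rewrite big_nat_recr//= -[leLHS]add0e leeD ?sume_ge0//.
  rewrite lee_fin mul1r big1// => k _; rewrite indicE mem_set// /I /= in_itv /=.
  have Ua : U i (a i) by apply: getPex; exists p.
  have := diam_ge Ui Ua; rewrite lE lee_fin => /(le_trans (ler_coord_norm _ 0 (inord k))).
  rewrite !mxE inordK ?ltn_ord; last by rewrite (leq_trans (ltn_ord k)).
  by rewrite ler_norml; lra.
have := cube_cover_mass e20 (fun i => ler01 : 0 <= c1 i) (fun i k => measurable_itv _) muI cov.
apply/negP; rewrite -ltNge.
have eps_l i : (1 * \prod_(k < n) (2 * l i / (e / 2)) <= eps^-1 * l i `^ d).
  rewrite mul1r prodr_const card_ord.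
  rewrite (_ : 2 * l i / (e / 2) = (e / 2 / 2)^-1 * l i); last first.
    by field; rewrite gt_eqF.
  rewrite exprMn exprVn ler_pM2l ?invr_gt0//.
  have [->|li0] := eqVneq (l i) 0; first by rewrite expr0n gtn_eqF// powR_ge0.
  rewrite -powR_mulrn// ger_powR// ?l1 ?andbT ?lt_neqAle ?l0 1?eq_sym ?li0//.
  exact: ltW.
apply: (@le_lt_trans _ _ ((eps^-1)%:E * \sum_(0 <= i <oo) diam (U i) `^ d)%E).
  rewrite -nneseriesZl; last by move=> i _; exact: poweR_ge0.
  apply: lee_nneseries => [i _ _|i _].
    by rewrite lee_fin mul1r prodr_ge0// => k _; rewrite divr_ge0 ?mulr_ge0// ltW.
  by rewrite lE poweR_EFin -EFinM lee_fin.
have : ((eps^-1)%:E * \sum_(0 <= i <oo) diam (U i) `^ d < (eps^-1)%:E * eps%:E)%E.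
  by rewrite lte_pmul2l// lte_fin invr_gt0.
by rewrite -EFinM mulVf// gt_eqF.
Qed.

(** The grid of K^n cells of side h costs K^n h^d, and K = 2e / h. *)
Lemma flat_cube_premeasure_le (d h : R) (K : nat) : 0 < d -> (0 < K)%N ->
  h = 2 * e / K%:R ->
  (hausdorff_premeasure d h (flat_cube (N := N) n e) <= ((2 * e) ^+ n * (h `^ d / h ^+ n))%:E)%E.
Proof.
move=> d0 K0 hE.
have Kr : 0 < K%:R :> R by rewrite ltr0n.
have h0 : 0 < h by rewrite hE divr_gt0// mulr_gt0.
pose C (f : {ffun 'I_n -> 'I_K}) : set 'rV[R]_N.+1 :=
  [set p | (forall (i : 'I_N.+1) (k : 'I_n), i = k :> nat ->
              (f k)%:R * h <= p 0 i + e <= (f k).+1%:R * h) /\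
           (forall i : 'I_N.+1, (n <= i)%N -> p 0 i = 0)].
have diamC f : (diam (C f) <= h%:E)%E.
  apply: diam_le => [|x y [xf x0] [yf y0]]; first exact: ltW.
  apply: norm_le_coord => [|i j]; first exact: ltW.
  rewrite ord1 !mxE; have [jn|jn] := ltnP j n; last first.
    by rewrite x0// y0// subrr normr0 ltW.
  have := xf j (Ordinal jn) erefl; have := yf j (Ordinal jn) erefl.
  by rewrite ler_norml -natr1 mulrDl mul1r; lra.
pose s := [seq C f | f <- enum {ffun 'I_n -> 'I_K}].
have ss : size s = (K ^ n)%N by rewrite size_map -cardE card_ffun !card_ord.
(* The finite cover is padded with empty sets, which contribute 0 since d > 0. *)
pose U i := nth set0 s i.
have diamU i : (diam (U i) <= h%:E)%E.
  have [si|si] := ltnP i (size s); last first.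
    by rewrite /U nth_default//; apply: diam_le => //; exact: ltW.
  by rewrite /U; have /mapP[f _ ->] := mem_nth set0 si; exact: diamC.
apply: ge_ereal_inf; exists (\sum_(0 <= i <oo) diam (U i) `^ d)%E.
  exists U; split=> // p [pe p0].
  have pos i : 0 <= (p 0 i + e) / h.
    by rewrite divr_ge0 ?(ltW h0)//; have := pe i; rewrite ltr_norml; lra.
  (* The strict bound p + e < 2e keeps the cell index below K. *)
  have fK (k : 'I_n) : (Num.trunc ((p 0 (inord k) + e) / h)%R < K)%N.
    have /andP[t _] := truncn_itv (pos (inord k)).
    rewrite -(ltr_nat R) (le_lt_trans t)// ltr_pdivrMr// hE mulrCA divff ?gt_eqF//.
    by have := pe (inord k); rewrite ltr_norml; lra.
  pose f : {ffun 'I_n -> 'I_K} := [ffun k => Ordinal (fK k)].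
  have Cp : C f p.
    split=> // i k ik; rewrite ffunE /= -ik inord_val.
    have /andP[t1 t2] := truncn_itv (pos i).
    by rewrite -ler_pdivlMr// t1 /= -ler_pdivrMr// ltW.
  have sC : C f \in s by rewrite map_f// mem_enum.
  by exists (index (C f) s) => //; rewrite /U nth_index.
have -> : (2 * e) ^+ n * (h `^ d / h ^+ n) = (K ^ n)%:R * h `^ d.
  rewrite natrX (_ : K%:R = 2 * e / h); last first.
    by rewrite hE invfM invrK mulrA mulfV ?mul1r// gt_eqF// mulr_gt0.
  by rewrite expr_div_n; ring.
have nn i : (0 <= diam (U i) `^ d)%E by exact: poweR_ge0.
apply: lime_le; first exact: is_cvg_nneseries.
near=> m; have mK : (K ^ n <= m)%N by near: m; exists (K ^ n)%N.
rewrite (big_cat_nat _ mK)//= [X in (_ + X)%E]big1_seq ?adde0; last first.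
  move=> i /andP[_]; rewrite mem_index_iota => /andP[i1 i2].
  by rewrite /U nth_default ?ss// diam_set0 poweR_EFin powR0// gt_eqF.
apply: (@le_trans _ _ (\sum_(0 <= i < K ^ n) (h `^ d)%:E)%E).
  apply: lee_sum => i _; rewrite -poweR_EFin.
  by apply: gt0_ler_poweR; rewrite ?in_itv/= ?leey ?diam_ge0 ?lee_fin ?(ltW d0) ?(ltW h0) ?diamU.
by rewrite sumEFin lee_fin sumr_const_nat subn0 mulr_natl.
Unshelve. all: by end_near.
Qed.

Lemma flat_cube_measure0 (d : R) : n%:R < d ->
  hausdorff_measure d (flat_cube (N := N) n e) = 0.
Proof.
move=> nd; have d0 : 0 < d by rewrite (le_lt_trans _ nd).
apply/eqP; rewrite eq_le; apply/andP; split; last first.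
  apply: le_trans (hausdorff_premeasure_ge0 d 1 _) _.
  by apply: ereal_sup_ubound; exists 1 => //=.
apply: ge_ereal_sup => _ [delta delta0 <-].
apply/lee_addgt0Pr => eps eps0; rewrite add0e.
pose s := d - n%:R; have s0 : 0 < s by rewrite subr_gt0.
have e2 : 0 < (2 * e) ^+ n by rewrite exprn_gt0// mulr_gt0.
(* Chosen so that (2e)^n eta^(d - n) = eps; a mesh below both [delta] and [eta] then gives a
   premeasure at most [eps]. *)
pose eta := (eps / (2 * e) ^+ n) `^ s^-1.
have eta0 : 0 < eta by rewrite powR_gt0// divr_gt0.
pose K := (Num.trunc (2 * e / Num.min delta eta)).+1.
have m0 : 0 < Num.min delta eta by rewrite lt_min delta0.
pose h := 2 * e / K%:R.
have h0 : 0 < h by rewrite divr_gt0 ?mulr_gt0.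
have hm : h <= Num.min delta eta.
  rewrite /h ler_pdivrMr ?ltr0n// -ler_pdivrMl// mulrC ltW//.
  by have /andP[] := truncn_itv (divr_ge0 (ltW (mulr_gt0 (ltr0n R 2) e0)) (ltW m0)).
have : (hausdorff_premeasure d h (flat_cube (N := N) n e) <= eps%:E)%E.
  apply: le_trans (@flat_cube_premeasure_le d h K d0 (ltn0Sn _) erefl) _.
  rewrite lee_fin -ler_pdivlMl// [leRHS]mulrC.
  have -> : h `^ d / h ^+ n = h `^ s.
    by rewrite -powR_mulrn ?ltW// -powRN -powRD// gt_eqF// implybT.
  have -> : eps / (2 * e) ^+ n = eta `^ s.
    by rewrite -powRrM mulVf ?gt_eqF// powRr1// ltW// divr_gt0.
  apply: ge0_ler_powR; rewrite ?nnegrE ?(ltW s0) ?(ltW h0) ?(ltW eta0)//.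
  by move: hm; rewrite le_min => /andP[].
apply: le_trans; apply: ereal_inf_le_tmp => _ [U [? Uh ->]].
exists U; split=> // i; apply: le_trans (Uh i) _; rewrite lee_fin.
by move: hm; rewrite le_min => /andP[].
Qed.

Lemma hausdorff_dim_flat_cube : (0 < n <= N.+1)%N ->
  hausdorff_dim (flat_cube (N := N) n e) = n%:R%:E.
Proof.
move=> nN; apply/eqP; rewrite eq_le; apply/andP; split.
  apply/lee_addgt0Pr => eps eps0; apply: ereal_inf_lbound.
  exists (n%:R + eps) => //; split; first by rewrite ltr_wpDl.
  by apply: flat_cube_measure0; rewrite ltrDl.
by apply: le_ereal_inf_tmp => _ [d [d0 H0] <-]; rewrite lee_fin flat_cube_dim_ge.
Qed.

End FlatCube.

(** * Trigonometric maps *)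

Section Dot.
Variables (R : realType) (n : nat).
Implicit Types u v w : 'rV[R]_n.

Lemma dotC u v : dot u v = dot v u.
Proof. by apply: eq_bigr => i _; rewrite mulrC. Qed.

Lemma dotDl u v w : dot (u + v) w = dot u w + dot v w.
Proof. by rewrite -big_split; apply: eq_bigr => i _; rewrite mxE mulrDl. Qed.

Lemma dotDr u v w : dot u (v + w) = dot u v + dot u w.
Proof. by rewrite dotC dotDl !(dotC u). Qed.

Lemma dotZl a u v : dot (a *: u) v = a * dot u v.
Proof. by rewrite /dot big_distrr; apply: eq_bigr => i _; rewrite mxE -mulrA. Qed.

Lemma dotZr a u v : dot u (a *: v) = a * dot u v.
Proof. by rewrite dotC dotZl dotC. Qed.

Lemma dotNl u v : dot (- u) v = - dot u v.
Proof. by rewrite -scaleN1r dotZl mulN1r. Qed.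

Lemma dotNr u v : dot u (- v) = - dot u v.
Proof. by rewrite dotC dotNl dotC. Qed.

Lemma dot0l v : dot 0 v = 0.
Proof. by rewrite -(scale0r v) dotZl mul0r. Qed.

Lemma dot_suml (I : Type) (s : seq I) (P : pred I) (F : I -> 'rV[R]_n) v :
  dot (\sum_(i <- s | P i) F i) v = \sum_(i <- s | P i) dot (F i) v.
Proof.
by elim/big_rec2 : _ => [|i y1 y2 _ <-]; rewrite ?dot0l ?dotDl.
Qed.

Lemma dot_sumr (I : Type) (s : seq I) (P : pred I) (F : I -> 'rV[R]_n) v :
  dot v (\sum_(i <- s | P i) F i) = \sum_(i <- s | P i) dot v (F i).
Proof. by rewrite dotC dot_suml; apply: eq_bigr => i _; rewrite dotC. Qed.

Lemma dot_ge0 u : 0 <= dot u u.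
Proof. by apply: sumr_ge0 => i _; rewrite -expr2 sqr_ge0. Qed.

Lemma dot_eq0 u : dot u u = 0 -> u = 0.
Proof.
move=> u0; apply/rowP => i; rewrite mxE; apply/eqP; rewrite -sqrf_eq0.
by move/eqP: u0; rewrite psumr_eq0 => [/allP/(_ i (mem_index_enum _))|j _];
  rewrite -expr2 ?sqr_ge0.
Qed.

Lemma dot_delta i u : dot u (delta_mx 0 i) = u 0 i.
Proof.
rewrite /dot (bigD1 i)//= mxE !eqxx mulr1 big1 ?addr0// => j ji.
by rewrite mxE (negbTE ji) mulr0.
Qed.

Lemma dot_mxvec (p q : nat) (A B : 'M[R]_(p, q)) :
  dot (mxvec A) (mxvec B) = \sum_i \sum_j A i j * B i j.
Proof.
rewrite pair_bigA /=; rewrite /dot (reindex _ (curry_mxvec_bij p q)).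
by apply: eq_bigr => -[i j] _ /=; rewrite !mxvecE.
Qed.

End Dot.

Section Phase.
Variables (R : realType) (n : nat).

Definition phase (xi u : 'rV[R]_n) : R := 2 * pi * dot xi u.

Lemma phase_is_linear (xi : 'rV[R]_n) : linear (phase xi : _ -> R^o).
Proof. by move=> a u v; rewrite /phase dotDr dotZr mulrDr mulrCA. Qed.

Lemma phaseD xi u v : phase xi (u + v) = phase xi u + phase xi v.
Proof. by rewrite /phase dotDr mulrDr. Qed.

Lemma phaseZ a xi u : phase xi (a *: u) = a * phase xi u.
Proof. by rewrite /phase dotZr mulrCA. Qed.

Lemma phaseNr xi u : phase xi (- u) = - phase xi u.
Proof. by rewrite /phase dotNr mulrN. Qed.

Lemma phaseNl xi u : phase (- xi) u = - phase xi u.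
Proof. by rewrite /phase dotNl mulrN. Qed.

End Phase.

Section PointwiseSum.
Variables (R : realType) (V W : normedModType R).

Lemma differentiable_fun_sum (N : nat) (f : 'I_N -> V -> W) (u : V) :
  (forall j, differentiable (f j) u) -> differentiable (fun z => \sum_j f j z) u.
Proof.
move=> df; rewrite (_ : (fun z => _) = \sum_j f j); first exact: differentiable_sum.
by apply/funext => z; rewrite fct_sumE.
Qed.

Lemma is_derive_fun_sum (N : nat) (f : 'I_N -> V -> W) (df : 'I_N -> W) (u v : V) :
  (forall j, is_derive u v (f j) (df j)) ->
  is_derive u v (fun z => \sum_j f j z) (\sum_j df j).
Proof.
move=> fd; rewrite (_ : (fun z => _) = \sum_j f j); first exact: is_derive_sum.
by apply/funext => z; rewrite fct_sumE.
Qed.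

Lemma is_derive_scalel (f : V -> R^o) (w : W) (u v : V) df :
  differentiable f u -> is_derive u v f df ->
  is_derive u v (fun z => f z *: w) (df *: w).
Proof.
move=> fu [_ dfE]; have d : differentiable (fun z => f z *: w) u by exact: differentiableZl.
apply: DeriveDef; first exact: diff_derivable.
by rewrite deriveE// diffZl//= -deriveE// dfE.
Qed.

Lemma is_derive_comp1 (h : R -> R) (dh : R) (f : V -> R^o) (u v : V) df :
  differentiable f u -> is_derive u v f df -> is_derive (f u) 1 h dh ->
  differentiable (h \o f : _ -> R^o) u /\ is_derive u v (h \o f : _ -> R^o) (dh * df).
Proof.
move=> fu [_ dfE] [hd dhE].
have hu : differentiable (h : R -> R^o) (f u) by apply/derivable1_diffP.
have dhf : differentiable (h \o f : _ -> R^o) u by exact: differentiable_comp.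
split; first exact: dhf.
apply: DeriveDef; first exact: (diff_derivable dhf).
rewrite (deriveE v dhf) (diff_comp fu hu) /= (diff1E hu) -(deriveE v fu) dfE derive1E dhE.
exact: mulrC.
Qed.

End PointwiseSum.

Section TrigMap.
Variables (R : realType) (n m N : nat) (xi : 'I_N -> 'rV[R]_n.+1).

Lemma differentiable_phase (k u : 'rV[R]_n.+1) : differentiable (phase k : _ -> R^o) u.
Proof.
have -> : (phase k : _ -> R^o) = \sum_i ((2 * pi * k 0 i) *: (fun u : 'rV[R]_n.+1 => u 0 i : R^o)).
  apply/funext => v; rewrite fct_sumE /phase /dot big_distrr /=.
  by apply: eq_bigr => i _; rewrite mulrA.
by apply: differentiable_sum => i; exact/differentiableZ/differentiable_coord.
Qed.

Lemma is_derive_phase (k u v : 'rV[R]_n.+1) :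
  is_derive u v (phase k : _ -> R^o) (phase k v).
Proof.
pose g : {linear 'rV[R]_n.+1 -> R^o} :=
  HB.pack (phase k : _ -> R^o) (GRing.isLinear.Build _ _ _ _ _ (phase_is_linear k)).
apply: DeriveDef; first exact/diff_derivable/differentiable_phase.
rewrite deriveE; last exact: differentiable_phase.
rewrite (_ : (phase k : _ -> R^o) = g)// diff_lin// => w.
exact/differentiable_continuous/differentiable_phase.
Qed.

(** This is [Theta xi u *m A] with the cosine rows and the sine rows of A separated. *)
Definition trig (a b : 'I_N -> 'rV[R]_m.+1) (u : 'rV[R]_n.+1) : 'rV[R]_m.+1 :=
  \sum_j (cos (phase (xi j) u) *: a j + sin (phase (xi j) u) *: b j).

Lemma trig_term_derive (a b : 'rV[R]_m.+1) (k u v : 'rV[R]_n.+1) :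
  differentiable (fun z => cos (phase k z) *: a + sin (phase k z) *: b) u /\
  is_derive u v (fun z => cos (phase k z) *: a + sin (phase k z) *: b)
    (cos (phase k u) *: (phase k v *: b) + sin (phase k u) *: (- phase k v *: a)).
Proof.
have dp := @differentiable_phase k u.
have ip := @is_derive_phase k u v.
have [dc ic] := is_derive_comp1 dp ip (is_derive_cos (phase k u)).
have [ds isin] := is_derive_comp1 dp ip (is_derive_sin (phase k u)).
split; first exact: (differentiableD (differentiableZl a dc) (differentiableZl b ds)).
rewrite addrC !scalerA mulrN -mulNr.
exact: (is_deriveD (is_derive_scalel a dc ic) (is_derive_scalel b ds isin)).
Qed.

Lemma differentiable_trig a b u : differentiable (trig a b) u.
Proof.
apply: differentiable_fun_sum => j.
by have [] := trig_term_derive (a j) (b j) (xi j) u 0.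
Qed.

Lemma derive_trigE a b v u : 'D_v (trig a b) u =
  trig (fun j => phase (xi j) v *: b j) (fun j => - phase (xi j) v *: a j) u.
Proof.
have h j := (trig_term_derive (a j) (b j) (xi j) u v).2.
by have [_ ->] := is_derive_fun_sum h.
Qed.

Lemma derive_trig a b v : 'D_v (trig a b) =
  trig (fun j => phase (xi j) v *: b j) (fun j => - phase (xi j) v *: a j).
Proof. by apply/funext => u; exact: derive_trigE. Qed.

(** Directional derivatives of these maps are again of the form [trig], with new coefficients, so
    differentiability of [trig] covers all iterated derivatives. *)
Lemma smooth_trig a b : smooth (trig a b).
Proof.
move=> vs u.
suff [a' [b' ->]] : exists a' b', foldr (fun v g => 'D_v g) (trig a b) vs = trig a' b'.
  exact: differentiable_trig.
elim: vs => [|v vs [a' [b' IH]]]; first by exists a, b.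
by rewrite /= IH derive_trig; eexists; eexists.
Qed.

End TrigMap.

(** * Frequencies of length one: minimality, periodicity, linear independence *)

Section UnitFrequencies.
Variables (R : realType) (n m N : nat) (xi : 'I_N -> 'rV[R]_n.+1).
Hypothesis xi_unit : forall j, dot (xi j) (xi j) = 1.
Implicit Types a b : 'I_N -> 'rV[R]_m.+1.

(** The second derivative along axis i multiplies the j-th frequency by -(2 pi)^2 times the square
    of the i-th coordinate of xi_j; these squares add up to 1. *)
Lemma trig_laplacian a b u :
  \sum_i partial (partial (trig xi a b) i) i u = - (2 * pi) ^+ 2 *: trig xi a b u.
Proof.
under eq_bigr do rewrite /partial derive_trig derive_trigE.
rewrite /trig. rewrite exchange_big scaler_sumr; apply: eq_bigr => j _.
have e i : phase (xi j) (delta_mx 0 i) = 2 * pi * xi j 0 i by rewrite /phase dot_delta.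
have s1 : \sum_i xi j 0 i * xi j 0 i = 1 by rewrite -(xi_unit j).
transitivity (\sum_i (- (2 * pi) ^+ 2 * (xi j 0 i * xi j 0 i)) *:
    (cos (phase (xi j) u) *: a j + sin (phase (xi j) u) *: b j)).
  apply: eq_bigr => i _; rewrite !e scalerDr !scalerA.
  by congr (_ *: _ + _ *: _); ring.
by rewrite -scaler_suml -mulr_sumr s1 mulr1.
Qed.

(* Takahashi: every component is an eigenfunction of the Laplacian, so the
   Laplacian of the map is proportional to the position vector. *)
Lemma minimal_trig a b (c : R) : c != 0 -> isometric_for c (trig xi a b) ->
  minimal_in_sphere (trig xi a b).
Proof.
move=> c0 iso u nu [nuf _]; rewrite iso invmx_scalar.
(* The metric is c times the identity, so the trace is the Laplacian divided by c. *)
transitivity (c^-1 * dot (\sum_i partial (partial (trig xi a b) i) i u) nu).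
  rewrite dot_suml mulr_sumr; apply: eq_bigr => i _.
  rewrite (bigD1 i)//= big1 ?addr0 => [|j ji]; rewrite !mxE; first by rewrite eqxx mulr1n.
  by rewrite eq_sym (negbTE ji) mulr0n mul0r.
by rewrite trig_laplacian dotZl dotC nuf !mulr0.
Qed.

Lemma trig_periodic a b (v : 'rV[R]_n.+1) u :
  (forall j, dot v (xi j) \is a Num.int) -> trig xi a b (u + v) = trig xi a b u.
Proof.
move=> vint; apply: eq_bigr => j _; rewrite phaseD.
have /intrP[k kE] := vint j.
have -> : phase (xi j) v = k%:~R * (pi *+ 2) by rewrite /phase dotC kE -(mulr_natl pi 2) mulrC.
suff h (l : nat) (x : R) : cos (x + l%:R * (pi *+ 2)) = cos x /\ sin (x + l%:R * (pi *+ 2)) = sin x.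
  case: k {kE} => l.
    by rewrite -pmulrn (h l _).1 (h l _).2.
  rewrite NegzE rmorphN /= -pmulrn.
  have := h l.+1 (phase (xi j) u + - l.+1%:R * (pi *+ 2)).
  by rewrite -addrA -mulrDl addNr mul0r addr0 => -[<- <-].
elim: l => [|l [IHc IHs]]; first by rewrite mul0r addr0.
by rewrite -natr1 mulrDl mul1r addrA cosD2pi sinD2pi.
Qed.

(** Strictness comes from |xi_i - xi_j|^2 and |xi_i + xi_j|^2 being nonzero. *)
Lemma unit_dot_lt1 i j : xi i <> xi j -> xi i <> - xi j -> `|dot (xi j) (xi i)| < 1.
Proof.
move=> ne1 ne2; have d1 := dot_ge0 (xi i - xi j); have d2 := dot_ge0 (xi i + xi j).
have n1 : dot (xi i - xi j) (xi i - xi j) != 0.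
  by apply/eqP => /dot_eq0 /eqP; rewrite subr_eq0 => /eqP.
have n2 : dot (xi i + xi j) (xi i + xi j) != 0.
  by apply/eqP => /dot_eq0 /eqP; rewrite addr_eq0 => /eqP.
move: d1 d2; rewrite 2!le_eqVlt ![0 == _]eq_sym (negbTE n1) (negbTE n2) /=.
rewrite !(dotDl, dotDr, dotNl, dotNr) !xi_unit (dotC (xi i)).
by rewrite ltr_norml; lra.
Qed.

(** The multiplier of a surviving frequency in the elimination below: for |c| < 1 the angle pi |c|
    stays short of pi, where cos is injective. *)
Lemma cos_pi_neqN1 (c : R) : `|c| < 1 -> 2 * cos (pi * c) + 2 != 0.
Proof.
move=> c1; have pi0 := pi_gt0 R.
have -> : cos (pi * c) = cos (pi * `|c|).
  by have [c0|c0] := leP 0 c; [rewrite ger0_norm|rewrite ltr0_norm// mulrN cosN].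
apply/eqP => e; have : cos (pi * `|c|) = cos pi by rewrite cospi; lra.
have h : pi * `|c| < pi by rewrite -[ltRHS]mulr1 ltr_pM2l.
move/cos_inj; rewrite !in_itv/= lexx (ltW pi0) mulr_ge0 ?(ltW pi0)//= (ltW h).
by move=> /(_ isT isT) /eqP; rewrite lt_eqF.
Qed.

Hypothesis xi_distinct : forall i j, xi i = xi j \/ xi i = - xi j -> i = j.

(* f(u + v) + f(u - v) + 2 f(u) with v = xi_i / 2 kills the i-th frequency and
   multiplies the j-th one by a nonzero constant. *)
Lemma trig_free a b : (forall u, trig xi a b u = 0) -> forall j, a j = 0 /\ b j = 0.
Proof.
pose T (a b : 'I_N -> 'rV[R]_m.+1) j u :=
  cos (phase (xi j) u) *: a j + sin (phase (xi j) u) *: b j.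
suff H (s : seq 'I_N) : uniq s -> forall a b, (forall u, \sum_(j <- s) T a b j u = 0) ->
    forall j, j \in s -> a j = 0 /\ b j = 0.
  move=> ab0 j; apply: (H (index_enum _)) => //; first exact: index_enum_uniq.
  exact: mem_index_enum.
elim: s => // i s IH /= /andP[i_s us] {}a {}b ab0.
pose v := 2^-1 *: xi i.
pose k j := 2 * cos (pi * dot (xi j) (xi i)) + 2.
have phv j : phase (xi j) v = pi * dot (xi j) (xi i).
  by rewrite phaseZ /phase; field.
have Tk j u : T a b j (u + v) + T a b j (u - v) + 2 *: T a b j u =
    T (fun j => k j *: a j) (fun j => k j *: b j) j u.
  rewrite /T /k !phaseD phaseNr phv !cosD !sinD cosN sinN.
  by apply/rowP => l; rewrite !mxE; ring.
have ki : k i = 0 by rewrite /k xi_unit mulr1 cospi; ring.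
have sk u : \sum_(j <- s) T (fun j => k j *: a j) (fun j => k j *: b j) j u = 0.
  have := ab0 (u + v); have := ab0 (u - v); have := ab0 u; rewrite !big_cons => e1 e2 e3.
  have := congr1 (fun w => 2 *: w) e1; rewrite scaler0 scalerDr => {}e1.
  have : (T a b i (u + v) + T a b i (u - v) + 2 *: T a b i u) +
    \sum_(j <- s) (T a b j (u + v) + T a b j (u - v) + 2 *: T a b j u) = 0.
    by rewrite big_split big_split /= -scaler_sumr addrACA (addrACA (T a b i (u + v))) e3 e2 e1 !addr0.
  have -> : T a b i (u + v) + T a b i (u - v) + 2 *: T a b i u = 0.
    by rewrite Tk /T ki !scale0r !scaler0 addr0.
  by rewrite add0r => h; rewrite -[RHS]h; apply: eq_bigr => j _; rewrite Tk.
have s0 j : j \in s -> a j = 0 /\ b j = 0.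
  move=> js; have [] := IH us _ _ sk j js.
  have kj : k j != 0.
    have ij : i <> j by move=> ij; move: i_s; rewrite ij js.
    apply: cos_pi_neqN1; apply: unit_dot_lt1 => h; apply: ij; apply: xi_distinct.
      by left.
    by right.
  by move=> /eqP + /eqP; rewrite !scaler_eq0 (negbTE kj) => /eqP -> /eqP ->.
have Ti u : T a b i u = 0.
  rewrite -(ab0 u) big_cons [X in _ + X]big1_seq ?addr0// => j /andP[_ /s0[aj bj]].
  by rewrite /T aj bj !scaler0 addr0.
(* Evaluation at 0 and at xi_i / 4, where the phase is 0 and pi / 2, isolates a_i and b_i. *)
move=> j; rewrite inE => /orP[/eqP ->|/s0//]; split.
  have := Ti 0; rewrite /T -(scale0r v) phaseZ mul0r cos0 sin0 scale1r scale0r.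
  by rewrite addr0.
have := Ti (2^-1 *: v); rewrite /T phaseZ phv xi_unit mulr1 mulrC cos_pihalf sin_pihalf.
by rewrite scale1r scale0r add0r.
Qed.

End UnitFrequencies.

(** * Comparison with the coordinates [Theta] *)

Section ThetaCoordinates.
Variables (R : realType) (n m N : nat) (xi : 'I_N -> 'rV[R]_n.+1).

Lemma mulmx_Theta (A : 'M[R]_(N * 2, m.+1)) u :
  Theta xi u *m A =
  trig xi (fun j => row (mxvec_index j 0) A) (fun j => row (mxvec_index j 1) A) u.
Proof.
apply/rowP => l; rewrite mxE (reindex _ (curry_mxvec_bij N 2)) /=.
transitivity (\sum_j \sum_c Theta xi u 0 (mxvec_index j c) * A (mxvec_index j c) l).
  by rewrite pair_bigA; apply: eq_bigr => -[].
rewrite /trig summxE; apply: eq_bigr => j _.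
rewrite big_ord_recl big_ord1 /Theta !mxvecE !mxE /=.
by congr (_ + _ * A (mxvec_index _ _) _); apply: val_inj.
Qed.

Definition rows_mx (a b : 'I_N -> 'rV[R]_m.+1) : 'M[R]_(N * 2, m.+1) :=
  \matrix_(i, l) mxvec (\matrix_(j < N, c < 2) (if c == 0 then a j else b j) 0 l) 0 i.

Lemma row_rows_mx a b j c :
  row (mxvec_index j c) (rows_mx a b) = if c == 0 then a j else b j.
Proof. by apply/rowP => l; rewrite !mxE mxvecE mxE. Qed.

Lemma mulmx_Theta_rows_mx a b u : Theta xi u *m rows_mx a b = trig xi a b u.
Proof.
rewrite mulmx_Theta /trig; apply: eq_bigr => j _.
by rewrite !row_rows_mx.
Qed.

End ThetaCoordinates.

(** * Unit vectors of the lattice *)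

Lemma ord3P (i : 'I_3) : [\/ i = 0, i = 1 | i = 2%:R].
Proof.
by case: i => -[|[|[|//]]] h; [apply: Or31|apply: Or32|apply: Or33]; apply: val_inj.
Qed.

Section Frequencies.
Variables (R : realType) (r : nat) (s t : int).

(* One representative of each antipodal pair of points of the circle
   b^2 + c^2 = r^2. *)
Definition circle_point (k : 'I_6) : int * int :=
  nth (0, 0) [:: (r%:Z, 0); (0, r%:Z); (s, t); (s, - t); (t, s); (t, - s)] k.

Definition unit_freq (b c : int) : 'rV[R]_3 :=
  vec3 (Num.sqrt 3)^-1 (Num.sqrt (2 / 3) * (b%:~R / r%:R)) (Num.sqrt (2 / 3) * (c%:~R / r%:R)).

(** [lshift] and [rshift] of the same k hold the two members xi_w, xi_(-w) of a pair. All twelve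
    have the positive first coordinate 1/sqrt 3, which selects one vector in each {xi, -xi}. *)
Definition freq (j : 'I_(6 + 6)) : 'rV[R]_3 :=
  match fintype.split j with
  | inl k => unit_freq (circle_point k).1 (circle_point k).2
  | inr k => unit_freq (- (circle_point k).1) (- (circle_point k).2)
  end.

Lemma vec3E (a b c : R) : (vec3 a b c 0 0 = a) * (vec3 a b c 0 1 = b) * (vec3 a b c 0 2%:R = c).
Proof. by rewrite !mxE. Qed.

Lemma dot3 (u v : 'rV[R]_3) :
  dot u v = u 0 0 * v 0 0 + u 0 1 * v 0 1 + u 0 2%:R * v 0 2%:R.
Proof.
rewrite /dot !big_ord_recl big_ord0 addr0 addrA.
by congr (_ + _ * _ + _ * _); congr (_ 0 _); apply: val_inj.
Qed.

Lemma eq_vec3 (u : 'rV[R]_3) : u = vec3 (u 0 0) (u 0 1) (u 0 2%:R).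
Proof. by apply/rowP => i; have [->|->|->] := ord3P i; rewrite vec3E. Qed.

Lemma sqr_sqrt3V : (Num.sqrt 3)^-1 ^+ 2 = 3^-1 :> R.
Proof. by rewrite exprVn sqr_sqrtr// ler0n. Qed.

Lemma sqr_sqrt23 : Num.sqrt (2 / 3) ^+ 2 = 2 / 3 :> R.
Proof. by rewrite sqr_sqrtr// divr_ge0// ler0n. Qed.

Hypothesis r_prime : prime r.
Hypothesis r_odd : odd r.
Hypothesis s0 : 0 < s.
Hypothesis t0 : 0 < t.
Hypothesis st : s ^+ 2 + t ^+ 2 = r%:Z ^+ 2.

Let r0 : r%:R != 0 :> R.
Proof. by rewrite pnatr_eq0 -lt0n prime_gt0. Qed.

Lemma lattice_star_coord (a b c : int) :
  a%:~R *: eta1 R + b%:~R *: eta2 R r + c%:~R *: eta3 R r =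
  vec3 ((2 * a - b - c)%:~R * (Num.sqrt 3)^-1)
       (Num.sqrt (2 / 3) * (b%:~R / r%:R)) (Num.sqrt (2 / 3) * (c%:~R / r%:R)).
Proof.
have e : Num.sqrt (2 / 3) * (1 / Num.sqrt 2) = (Num.sqrt 3)^-1 :> R.
  by rewrite sqrtrM ?ler0n// sqrtrV ?ler0n// mul1r mulrAC mulfV ?mul1r// sqrtr_eq0 -ltNge ltr0n.
rewrite [LHS]eq_vec3 !(vec3E, mxE) /=; congr vec3; last 2 first.
- by rewrite !mulr0 !(add0r, addr0); ring.
- by rewrite !mulr0 !(add0r, addr0); ring.
by rewrite mulrN e !rmorphB rmorphM /=; ring.
Qed.

Lemma circle_pointP (b c : int) : b ^+ 2 + c ^+ 2 = r%:Z ^+ 2 <->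
  exists k, (b, c) = circle_point k \/ (b, c) = (- (circle_point k).1, - (circle_point k).2).
Proof.
have pt b' c' (k : 'I_6) : circle_point k = (b', c') ->
    ((b, c) = (b', c') \/ (b, c) = (- b', - c')) ->
    exists k, (b, c) = circle_point k \/
      (b, c) = (- (circle_point k).1, - (circle_point k).2).
  by move=> kE h; exists k; rewrite kE.
split.
  move=> bc; have := sum_two_squares_prime_sqr r_prime r_odd s0 t0 st bc.
  have sg (x y : int) : `|x| = y -> x = y \/ x = - y.
    by move=> <-; have [x0|x0] := lerP 0 x; [left; rewrite ger0_norm|right;
      rewrite ltr0_norm ?opprK].
  case=> -[].
  - by move=> /sg bE cE; apply: (pt r%:Z 0 (inord 0));
      [rewrite /circle_point inordK|rewrite oppr0 cE; case: bE => ->; [left|right]].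
  - by move=> bE /sg cE; apply: (pt 0 r%:Z (inord 1));
      [rewrite /circle_point inordK|rewrite oppr0 bE; case: cE => ->; [left|right]].
  - move=> /sg bE /sg cE; case: bE => bE; case: cE => cE.
    + by apply: (pt s t (inord 2)); [rewrite /circle_point inordK|left; rewrite bE cE].
    + by apply: (pt s (- t) (inord 3)); [rewrite /circle_point inordK|left; rewrite bE cE].
    + by apply: (pt s (- t) (inord 3)); [rewrite /circle_point inordK|right;
        rewrite bE cE ?opprK].
    + by apply: (pt s t (inord 2)); [rewrite /circle_point inordK|right; rewrite bE cE].
  - move=> /sg bE /sg cE; case: bE => bE; case: cE => cE.
    + by apply: (pt t s (inord 4)); [rewrite /circle_point inordK|left; rewrite bE cE].
    + by apply: (pt t (- s) (inord 5)); [rewrite /circle_point inordK|left; rewrite bE cE].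
    + by apply: (pt t (- s) (inord 5)); [rewrite /circle_point inordK|right;
        rewrite bE cE ?opprK].
    + by apply: (pt t s (inord 4)); [rewrite /circle_point inordK|right; rewrite bE cE].
suff h k : (circle_point k).1 ^+ 2 + (circle_point k).2 ^+ 2 = r%:Z ^+ 2.
  by case=> k [kE|[-> ->]]; rewrite ?sqrrN; have := h k; rewrite -?kE.
rewrite /circle_point; case: k => -[|[|[|[|[|[|//]]]]]] _ /=;
  by rewrite ?sqrrN ?expr0n ?addr0 ?add0r // addrC.
Qed.

Lemma circle_point_inj (i j : 'I_6) : circle_point i = circle_point j \/
  circle_point i = (- (circle_point j).1, - (circle_point j).2) -> i = j.
Proof.
have r1 : 0 < r%:Z by have := prime_gt0 r_prime; lia.
(* If s = t then r^2 = 2 t^2 would be even; without this the last four points would not be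
   distinct. *)
have st' : s != t.
  apply/eqP => e; have /(congr1 (fun z : int => odd `|z|%N)) : r%:Z ^+ 2 = 2 * t ^+ 2.
    by rewrite -st e; ring.
  by rewrite abszM abszX oddX oddM r_odd.
move/eqP: st' => st' H.
have {H} : (circle_point i).1 = (circle_point j).1 /\ (circle_point i).2 = (circle_point j).2 \/
    (circle_point i).1 = - (circle_point j).1 /\ (circle_point i).2 = - (circle_point j).2.
  by case: H => ->; [left|right].
rewrite /circle_point; case: i j => -[|[|[|[|[|[|//]]]]]] ? [[|[|[|[|[|[|//]]]]]] ?] /=;
  try (by move=> _; apply: val_inj); clear st r_odd; lia.
Qed.

Lemma circle_point_neqN (i j : 'I_6) :
  circle_point i <> (- (circle_point j).1, - (circle_point j).2).
Proof.
move=> e; have ij : i = j by apply: circle_point_inj; right.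
have : (circle_point i).1 ^+ 2 + (circle_point i).2 ^+ 2 = r%:Z ^+ 2.
  by apply/circle_pointP; exists i; left; rewrite -surjective_pairing.
have r2 : 0 < r%:Z ^+ 2 by rewrite exprn_gt0// ltz_nat prime_gt0.
by move: e; rewrite -ij; case: (circle_point i) => x y /= [] ? ?; nia.
Qed.

Lemma unit_freq_inj b c b' c' : unit_freq b c = unit_freq b' c' -> (b, c) = (b', c').
Proof.
have tau0 : Num.sqrt (2 / 3) != 0 :> R.
  by rewrite sqrtr_eq0 -ltNge divr_gt0 ?ltr0n.
have inj (x y : int) : Num.sqrt (2 / 3) * (x%:~R / r%:R) = Num.sqrt (2 / 3) * (y%:~R / r%:R) :> R -> x = y.
  by move=> /(mulfI tau0) /(divIf r0) /eqP; rewrite eqr_int => /eqP.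
move=> /rowP e; have := e 1; have := e 2%:R; rewrite /unit_freq !vec3E.
by move=> /inj -> /inj ->.
Qed.

Lemma unit_freq_neqN b c b' c' : unit_freq b c <> - unit_freq b' c'.
Proof.
move=> /rowP/(_ 0); rewrite /unit_freq [RHS]mxE !vec3E => e.
have : 0 < (Num.sqrt 3)^-1 :> R by rewrite invr_gt0 sqrtr_gt0 ltr0n.
by rewrite e oppr_gt0; apply/negP; rewrite -leNgt invr_ge0 sqrtr_ge0.
Qed.

Lemma dot_vec3 (k : R) (b c : int) :
  let v := vec3 (k * (Num.sqrt 3)^-1) (Num.sqrt (2 / 3) * (b%:~R / r%:R)) (Num.sqrt (2 / 3) * (c%:~R / r%:R)) in
  (dot v v = 1) <-> (k ^+ 2 * r%:R ^+ 2 + 2 * (b%:~R ^+ 2 + c%:~R ^+ 2) = 3 * r%:R ^+ 2 :> R).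
Proof.
move=> v.
have -> : dot v v = (k ^+ 2 * r%:R ^+ 2 + 2 * (b%:~R ^+ 2 + c%:~R ^+ 2)) / (3 * r%:R ^+ 2).
  rewrite dot3 !vec3E -!expr2 !exprMn sqr_sqrt3V sqr_sqrt23.
  by field.
have d0 : 3 * r%:R ^+ 2 != 0 :> R by rewrite mulf_neq0 ?expf_neq0// pnatr_eq0.
split=> [e|->]; last by rewrite divff.
by rewrite -[LHS](divfK d0) e mul1r.
Qed.

Lemma unit_freq_norm b c : b ^+ 2 + c ^+ 2 = r%:Z ^+ 2 -> dot (unit_freq b c) (unit_freq b c) = 1.
Proof.
move=> bc; rewrite /unit_freq -[(Num.sqrt 3)^-1]mul1r; apply/dot_vec3.
have -> : r%:R ^+ 2 = b%:~R ^+ 2 + c%:~R ^+ 2 :> R.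
  by have := congr1 (intr : int -> R) bc; rewrite rmorphD !rmorphXn /= -pmulrn.
by ring.
Qed.

Lemma unit_freqN b c : - unit_freq b c =
  vec3 ((-1) * (Num.sqrt 3)^-1) (Num.sqrt (2 / 3) * ((- b)%:~R / r%:R)) (Num.sqrt (2 / 3) * ((- c)%:~R / r%:R)).
Proof.
rewrite [LHS]eq_vec3 /unit_freq; congr vec3; rewrite [LHS]mxE vec3E ?rmorphN /=; ring.
Qed.

Lemma lattice_star_unit_freq b c : b ^+ 2 + c ^+ 2 = r%:Z ^+ 2 ->
  lattice_star r (unit_freq b c) /\ lattice_star r (- unit_freq b c).
Proof.
move=> bc.
(* (b + c)^2 = r^2 + 2bc is odd, so b + c is odd and a = (b + c + 1) / 2 is an integer. *)
have [a aE] : exists a : int, 2 * a - b - c = 1.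
  have : odd `|(b + c)%R|%N.
    have : odd `|((b + c) ^+ 2)%R|%N; last by rewrite abszX oddX.
    have -> : (b + c) ^+ 2 = r%:Z ^+ 2 + 2 * (b * c) by rewrite -bc; ring.
    have : odd `|(r%:Z ^+ 2)%R|%N by rewrite abszX oddX r_odd.
    by move: (r%:Z ^+ 2) (b * c); clear; lia.
  by move=> h; exists ((b + c + 1) %/ 2)%Z; lia.
split; first by exists a, b, c; rewrite lattice_star_coord aE mul1r.
exists (- a), (- b), (- c); rewrite lattice_star_coord unit_freqN.
by rewrite (_ : 2 * - a - - b - - c = -1) ?rmorphN1//; lia.
Qed.

Lemma freq_unit_freq j : exists b c, freq j = unit_freq b c /\ b ^+ 2 + c ^+ 2 = r%:Z ^+ 2.
Proof.
rewrite /freq; case: (fintype.split j) => k; eexists; eexists; split; try reflexivity;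
  apply/circle_pointP; exists k; [left|by right].
by case: (circle_point k).
Qed.

(** With k = 2a - b - c, unit length reads k^2 r^2 + 2(b^2 + c^2) = 3 r^2. Hence k^2 <= 3, and k = 0
    is impossible because 3 r^2 is odd; so k is 1 or -1, its sign choosing xi or -xi, and b^2 + c^2
    = r^2. *)
Lemma freq_unit_vectors : unit_vectors_up_to_sign (lattice_star (R := R) r) freq.
Proof.
split=> [v|i j]; first split.
- case=> -[a [b [c ->]]]; rewrite lattice_star_coord => /dot_vec3 e.
  set k := 2 * a - b - c in e *.
  have {}e : k ^+ 2 * r%:Z ^+ 2 + 2 * (b ^+ 2 + c ^+ 2) = 3 * r%:Z ^+ 2.
    apply/eqP; rewrite -(eqr_int R); apply/eqP.
    by move: (k) e => k' e; apply: etrans (etrans e _); ring.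
  have r2 : 0 < r%:Z ^+ 2 by rewrite exprn_gt0// ltz_nat prime_gt0.
  have k3 : k ^+ 2 <= 3.
    rewrite -(ler_pM2r r2) -e lerDl mulr_ge0// addr_ge0 ?sqr_ge0//.
  have ro : odd `|(r%:Z ^+ 2)%R|%N by rewrite abszX oddX r_odd.
  have k0 : k != 0 by apply/eqP => k0; move: e; rewrite k0 expr0n mul0r add0r; move: ro;
    clear; lia.
  have k1 : k = 1 \/ k = - 1 by move: k0 k3; clear; nia.
  have bc : b ^+ 2 + c ^+ 2 = r%:Z ^+ 2.
    by move: e; case: k1 => ->; rewrite ?sqrrN expr1n mul1r; clear; lia.
  case: k1 => ->.
    have [l [] e'] := (circle_pointP b c).1 bc.
      exists (lshift 6 l); left; rewrite /freq (unsplitK (inl l)) -e' /=.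
      by rewrite /unit_freq mul1r.
    exists (rshift 6 l); left; rewrite /freq (unsplitK (inr l)); case: e' => <- <-.
    by rewrite /unit_freq mul1r.
  have bcN : (- b) ^+ 2 + (- c) ^+ 2 = r%:Z ^+ 2 by rewrite !sqrrN.
  have [l [] e'] := (circle_pointP (- b) (- c)).1 bcN.
    exists (lshift 6 l); right; rewrite /freq (unsplitK (inl l)) -e' /=.
    by rewrite unit_freqN !opprK.
  exists (rshift 6 l); right; rewrite /freq (unsplitK (inr l)); case: e' => <- <-.
  by rewrite unit_freqN !opprK.
- case=> j; have [b [c [-> /[dup] /unit_freq_norm n1 /lattice_star_unit_freq[l1 l2]]]] :=
    freq_unit_freq j.
  by case=> ->; split; rewrite ?dotNl ?dotNr ?opprK.
have [b [c [ie _]]] := freq_unit_freq i; have [b' [c' [je _]]] := freq_unit_freq j.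
case=> [ij|]; last by rewrite ie je => /unit_freq_neqN.
move: ij; rewrite -[i]splitK -[j]splitK /freq.
case: (fintype.split i) => k; case: (fintype.split j) => l;
  rewrite !unsplitK => /unit_freq_inj[e1 e2].
- by congr (lshift _ _); apply: circle_point_inj;
    left; rewrite [LHS]surjective_pairing e1 e2 -surjective_pairing.
- by case: (@circle_point_neqN k l); rewrite [LHS]surjective_pairing e1 e2.
- by case: (@circle_point_neqN l k); rewrite [LHS]surjective_pairing -e1 -e2.
- by congr (rshift _ _); apply: circle_point_inj;
    left; rewrite [LHS]surjective_pairing (oppr_inj e1) (oppr_inj e2) -surjective_pairing.
Qed.

End Frequencies.

(** * Gram matrices *)

(* mxvec with its length 6 * 6 presented as a successor. *)
Definition flat (R : realType) (M : 'M[R]_6) : 'rV[R]_(35.+1) := mxvec M.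

Definition flat_index (k l : 'I_6) : 'I_(35.+1) := mxvec_index k l.

Lemma flatE (R : realType) (M : 'M[R]_6) k l : flat M 0 (flat_index k l) = M k l.
Proof. exact: mxvecE. Qed.

Lemma dot_flat (R : realType) (A B : 'M[R]_6) :
  dot (flat A) (flat B) = \sum_i \sum_j A i j * B i j.
Proof. exact: (@dot_mxvec R 6 6 A B). Qed.

Lemma flat_rowP (R : realType) (u v : 'rV[R]_(35.+1)) :
  (forall k l, u 0 (flat_index k l) = v 0 (flat_index k l)) -> u = v.
Proof.
move=> uv; apply/rowP => i.
suff [k [l ->]] : exists k l, i = flat_index k l by exact: uv.
suff h (j : 'I_(6 * 6)) : exists k l, j = mxvec_index k l by exact: (h i).
by case/mxvec_indexP: j => k l; exists k, l.
Qed.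

Section GramVectors.
Variables (R : realType) (al be P Q : 'I_6 -> R).

Definition block_vec (k : 'I_6) (s : seq R) : 'rV[R]_(35.+1) :=
  flat (\matrix_(i < 6, l < 6) (s`_l *+ (i == k))).

(* A Cholesky factorization of the 4 x 4 Gram matrix of each pair {w, - w}, in a
   block of R^6 rather than R^4: splitting off the constant 1/16 < al makes the
   entries continuous in the parameters without dividing by al. *)
Definition cos_coef (j : 'I_(6 + 6)) : 'rV[R]_(35.+1) :=
  match fintype.split j with
  | inl k => block_vec k [:: 1 / 4; 0; Num.sqrt (al k - 1 / 16); 0; 0; 0]
  | inr k => block_vec k [:: 4 * P k; 4 * Q k; 0; 0;
                             Num.sqrt (be k - 16 * (P k ^+ 2 + Q k ^+ 2)); 0]
  end.

Definition sin_coef (j : 'I_(6 + 6)) : 'rV[R]_(35.+1) :=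
  match fintype.split j with
  | inl k => block_vec k [:: 0; 1 / 4; 0; Num.sqrt (al k - 1 / 16); 0; 0]
  | inr k => block_vec k [:: 4 * Q k; - (4 * P k); 0; 0; 0;
                             Num.sqrt (be k - 16 * (P k ^+ 2 + Q k ^+ 2))]
  end.

Hypothesis al_ge : forall k, 1 / 16 <= al k.
Hypothesis be_ge : forall k, 16 * (P k ^+ 2 + Q k ^+ 2) <= be k.

(** The values of the map, its partial derivatives and the single coefficients are all of this form,
    so one inner product formula serves for the sphere condition, the metric and the Gram
    entries. *)
Definition coef_comb (X Y : 'I_(6 + 6) -> R) : 'rV[R]_(35.+1) :=
  \sum_j (X j *: cos_coef j + Y j *: sin_coef j).

Lemma coef_comb_flat X Y : coef_comb X Y = flat (\matrix_(k < 6, l < 6)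
  (X (lshift 6 k) * [:: 1 / 4; 0; Num.sqrt (al k - 1 / 16); 0; 0; 0]`_l +
   Y (lshift 6 k) * [:: 0; 1 / 4; 0; Num.sqrt (al k - 1 / 16); 0; 0]`_l +
   X (rshift 6 k) * [:: 4 * P k; 4 * Q k; 0; 0;
                        Num.sqrt (be k - 16 * (P k ^+ 2 + Q k ^+ 2)); 0]`_l +
   Y (rshift 6 k) * [:: 4 * Q k; - (4 * P k); 0; 0; 0;
                        Num.sqrt (be k - 16 * (P k ^+ 2 + Q k ^+ 2))]`_l)).
Proof.
apply: flat_rowP => k l; rewrite /coef_comb summxE flatE mxE big_split_ord /=.
rewrite (bigD1 k)//= [X in _ + _ + X](bigD1 k)//= !big1 => [|i ik|i ik];
  rewrite !mxE /cos_coef /sin_coef ?(unsplitK (inl _)) ?(unsplitK (inr _)) !flatE !mxE.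
- by rewrite eqxx !mulr1n !addr0 !addrA.
- by rewrite eq_sym (negbTE ik) !mulr0n !mulr0 addr0.
- by rewrite eq_sym (negbTE ik) !mulr0n !mulr0 addr0.
Qed.

(** The signs at P and Q are those of the addition formulas: with X = cos and Y = sin, only cos and
    sin of the sum of the two phases of a pair remain in the cross terms. *)
Lemma dot_coef_comb X Y X' Y' : dot (coef_comb X Y) (coef_comb X' Y') =
  \sum_(k < 6)
   (al k * (X (lshift 6 k) * X' (lshift 6 k) + Y (lshift 6 k) * Y' (lshift 6 k)) +
    be k * (X (rshift 6 k) * X' (rshift 6 k) + Y (rshift 6 k) * Y' (rshift 6 k)) +
    P k * (X (lshift 6 k) * X' (rshift 6 k) + X (rshift 6 k) * X' (lshift 6 k) -
           Y (lshift 6 k) * Y' (rshift 6 k) - Y (rshift 6 k) * Y' (lshift 6 k)) +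
    Q k * (X (lshift 6 k) * Y' (rshift 6 k) + Y (rshift 6 k) * X' (lshift 6 k) +
           Y (lshift 6 k) * X' (rshift 6 k) + X (rshift 6 k) * Y' (lshift 6 k))).
Proof.
rewrite !coef_comb_flat dot_flat; apply: eq_bigr => k _.
rewrite !big_ord_recl big_ord0 !mxE /=.
have := sqr_sqrtr (_ : 0 <= al k - 1 / 16); rewrite subr_ge0 al_ge => /(_ isT).
have := sqr_sqrtr (_ : 0 <= be k - 16 * (P k ^+ 2 + Q k ^+ 2)).
rewrite subr_ge0 be_ge => /(_ isT).
move: (Num.sqrt _) => g; move: (Num.sqrt _) => h ge he.
have -> : al k = h ^+ 2 + 1 / 16 by rewrite he; ring.
have -> : be k = g ^+ 2 + 16 * (P k ^+ 2 + Q k ^+ 2) by rewrite ge; ring.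
by field.
Qed.

Lemma coef_comb_indicator j : (coef_comb (fun i => (i == j)%:R) (fun=> 0) = cos_coef j) *
  (coef_comb (fun=> 0) (fun i => (i == j)%:R) = sin_coef j).
Proof.
split; rewrite /coef_comb (bigD1 j)//= eqxx big1 ?addr0 => [|i ij];
  by rewrite ?(negbTE ij) !scale0r ?scale1r ?addr0 ?add0r.
Qed.

Lemma eq_shiftE (k l : 'I_6) :
  ((lshift 6 k == lshift 6 l) = (k == l)) * ((rshift 6 k == rshift 6 l) = (k == l)) *
  ((lshift 6 k == rshift 6 l) = false) * ((rshift 6 k == lshift 6 l) = false).
Proof. by rewrite eq_lshift eq_rshift eq_lrshift eq_rlshift. Qed.

Lemma dot_cos_coef_l k : dot (cos_coef (lshift 6 k)) (cos_coef (lshift 6 k)) = al k.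
Proof.
rewrite -(coef_comb_indicator _).1 dot_coef_comb (bigD1 k)//= big1 ?addr0 => [|i ik];
  rewrite !eq_shiftE; first by rewrite eqxx mulr1n ?mulr0n; ring.
by rewrite (negbTE ik) !mulr0n; ring.
Qed.

Lemma dot_cos_coef_r k : dot (cos_coef (rshift 6 k)) (cos_coef (rshift 6 k)) = be k.
Proof.
rewrite -(coef_comb_indicator _).1 dot_coef_comb (bigD1 k)//= big1 ?addr0 => [|i ik];
  rewrite !eq_shiftE; first by rewrite eqxx mulr1n ?mulr0n; ring.
by rewrite (negbTE ik) !mulr0n; ring.
Qed.

Lemma dot_cos_coef_lr k : dot (cos_coef (lshift 6 k)) (cos_coef (rshift 6 k)) = P k.
Proof.
rewrite -!(coef_comb_indicator _).1 dot_coef_comb (bigD1 k)//= big1 ?addr0 => [|i ik];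
  rewrite !eq_shiftE; first by rewrite eqxx mulr1n ?mulr0n; ring.
by rewrite (negbTE ik) !mulr0n; ring.
Qed.

Lemma dot_cos_sin_coef_lr k : dot (cos_coef (lshift 6 k)) (sin_coef (rshift 6 k)) = Q k.
Proof.
rewrite -(coef_comb_indicator _).1 -(coef_comb_indicator _).2 dot_coef_comb (bigD1 k)//= big1 ?addr0 => [|i ik];
  rewrite !eq_shiftE; first by rewrite eqxx mulr1n ?mulr0n; ring.
by rewrite (negbTE ik) !mulr0n; ring.
Qed.

Lemma coef_orthogonal i j : (forall k, P k = 0) -> (forall k, Q k = 0) ->
  [/\ i != j -> dot (cos_coef i) (cos_coef j) = 0,
      i != j -> dot (sin_coef i) (sin_coef j) = 0,
      dot (cos_coef i) (sin_coef j) = 0 &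
      dot (sin_coef i) (cos_coef j) = 0].
Proof.
move=> P0 Q0.
have e X Y X' Y' : (forall l, X l * X' l + Y l * Y' l = 0) -> dot (coef_comb X Y) (coef_comb X' Y') = 0.
  by move=> h; rewrite dot_coef_comb big1// => k _; rewrite P0 Q0 !h; ring.
split=> [ij|ij||]; rewrite -?(coef_comb_indicator i).1 -?(coef_comb_indicator j).1
  -?(coef_comb_indicator i).2 -?(coef_comb_indicator j).2;
      apply: e => l; rewrite ?mulr0 ?mul0r ?addr0 ?add0r//;
  by case: eqVneq => [->|_]; rewrite ?mul0r// (negbTE ij) mulr0.
Qed.

End GramVectors.

(** * Joint continuity in the coefficients and the point *)

Section Continuity.
Variable R : realType.

Lemma continuous_row (T : topologicalType) (n : nat) (f : T -> 'rV[R]_n.+1) :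
  (forall l, continuous (fun z => f z 0 l : R)) -> continuous f.
Proof.
move=> fc; rewrite (_ : f = fun z => \sum_l f z 0 l *: delta_mx 0 l); last first.
  by apply/funext => z; rewrite -row_sum_delta.
apply: continuous_big => [|l _ z]; first exact: add_continuous.
by apply: cvgZr_tmp; exact: fc.
Qed.

Lemma continuous_phase (n : nat) (k : 'rV[R]_n.+1) : continuous (phase k : _ -> R).
Proof. by move=> u; apply: differentiable_continuous; exact: differentiable_phase. Qed.

Lemma continuous_block_vec (T : topologicalType) (k : 'I_6) (s : T -> seq R) :
  (forall i, (i < 6)%N -> continuous (fun z => (s z)`_i : R)) ->
  continuous (fun z => block_vec k (s z)).
Proof.
move=> sc; apply: continuous_row => i.
suff h a b : continuous (fun z => block_vec k (s z) 0 (flat_index a b) : R).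
  suff [a [b ->]] : exists a b, i = flat_index a b by [].
  suff h' (j : 'I_(6 * 6)) : exists k l, j = mxvec_index k l by exact: (h' i).
  by case/mxvec_indexP: j => x y; exists x, y.
under [X in continuous X]funext do rewrite flatE mxE.
case: (a == k) => /=; last exact: cst_continuous.
exact: sc.
Qed.

Lemma continuous_trig (T : topologicalType) (n m N : nat) (xi : 'I_N -> 'rV[R]_n.+1)
    (a b : T -> 'I_N -> 'rV[R]_m.+1) :
  (forall j, continuous (fun z => a z j)) -> (forall j, continuous (fun z => b z j)) ->
  continuous (fun zu : T * 'rV[R]_n.+1 => trig xi (a zu.1) (b zu.1) zu.2).
Proof.
move=> ac bc; rewrite /trig; apply: continuous_big => [|j _ z]; first exact: add_continuous.
have p2 : (phase (xi j) zu.2 @[zu --> z]) --> phase (xi j) z.2.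
  by apply: continuous_comp; [exact: cvg_snd|exact: continuous_phase].
have a2 : (a zu.1 j @[zu --> z]) --> a z.1 j.
  by apply: (@continuous_comp _ _ _ fst (fun z => a z j)); [exact: cvg_fst|exact: ac].
have b2 : (b zu.1 j @[zu --> z]) --> b z.1 j.
  by apply: (@continuous_comp _ _ _ fst (fun z => b z j)); [exact: cvg_fst|exact: bc].
apply: cvgD; apply: cvgZ => //.
  by apply: (cvg_comp _ _ p2); exact: continuous_cos.
by apply: (cvg_comp _ _ p2); exact: continuous_sin.
Qed.

End Continuity.

(** * The thirteen parameters *)

Section ParameterSpace.
Variables (R : realType) (S T : R).

(** With S = s/r and T = t/r, the coordinates of the points [circle_point] divided by r. *)
Definition circle_x (k : 'I_6) : R := [:: 1; 0; S; S; T; T]`_k.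
Definition circle_y (k : 'I_6) : R := [:: 0; 1; T; - T; S; - S]`_k.

(* The kernel of z |-> (sum z_k, sum z_k cos 2 phi_k, sum z_k sin 2 phi_k), where
   (cos phi_k, sin phi_k) = (circle_x k, circle_y k). *)
Definition moment2_ker (a b c : R) (k : 'I_6) : R :=
  let C := S ^+ 2 - T ^+ 2 in
  [:: - (a + c) - C * (a - c); - (a + c) + C * (a - c); a + b; a - b; c - b; c + b]`_k.

(* The kernel of z |-> (sum z_k cos phi_k, sum z_k sin phi_k). *)
Definition moment1_ker (a b c d : R) (k : 'I_6) : R :=
  [:: - (S * (a + b) + T * (c + d)); - (T * (a - b) + S * (c - d)); a; b; c; d]`_k.

Definition par (p : 'rV[R]_13) (i : nat) : R := p 0 (inord i).

(** 1/6 is twice the uniform weight 1/12, the particular solution of the inhomogeneous equations. *)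
Definition weight_sum (p : 'rV[R]_13) (k : 'I_6) : R :=
  1 / 6 + moment2_ker (par p 0) (par p 1) (par p 2) k.

Definition weight_diff (p : 'rV[R]_13) : 'I_6 -> R :=
  moment1_ker (par p 3) (par p 4) (par p 5) (par p 6).

Definition weight_l p k : R := (weight_sum p k + weight_diff p k) / 2.
Definition weight_r p k : R := (weight_sum p k - weight_diff p k) / 2.

Definition cross_cos (p : 'rV[R]_13) : 'I_6 -> R :=
  moment2_ker (par p 7) (par p 8) (par p 9).

Definition cross_sin (p : 'rV[R]_13) : 'I_6 -> R :=
  moment2_ker (par p 10) (par p 11) (par p 12).

Lemma parameters_inj p q :
  (forall k, weight_l p k = weight_l q k) -> (forall k, weight_r p k = weight_r q k) ->
  (forall k, cross_cos p k = cross_cos q k) -> (forall k, cross_sin p k = cross_sin q k) ->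
  p = q.
Proof.
move=> hl hr hc hs.
have hsum k : weight_sum p k = weight_sum q k.
  by have := hl k; have := hr k; rewrite /weight_l /weight_r; lra.
have hdiff k : weight_diff p k = weight_diff q k.
  by have := hl k; have := hr k; rewrite /weight_l /weight_r; lra.
have ker2 a b c a' b' c' : (forall k, moment2_ker a b c k = moment2_ker a' b' c' k) ->
    [/\ a = a', b = b' & c = c'].
  (* Entries 2, 3 and 5 are a + b, a - b and c + b, which determine a, b and c. *)
  move=> h; have := h (inord 2); have := h (inord 3); have := h (inord 5).
  by rewrite /moment2_ker !inordK//= => h1 h2 h3; split; lra.
have [|p0 p1 p2] := @ker2 (par p 0) (par p 1) (par p 2) (par q 0) (par q 1) (par q 2).
  by move=> k; have := hsum k; rewrite /weight_sum; lra.
have [p7 p8 p9] := ker2 _ _ _ _ _ _ hc.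
have [p10 p11 p12] := ker2 _ _ _ _ _ _ hs.
have [p3 p4 p5 p6] : [/\ par p 3 = par q 3, par p 4 = par q 4, par p 5 = par q 5 & par p 6 = par q 6].
  have := hdiff (inord 2); have := hdiff (inord 3); have := hdiff (inord 4);
    have := hdiff (inord 5).
  by rewrite /weight_diff /moment1_ker !inordK.
apply/rowP => i; rewrite -[i]inord_val -!/(par _ _).
by case: i => -[|[|[|[|[|[|[|[|[|[|[|[|[|//]]]]]]]]]]]]].
Qed.

Lemma cross_eq0P p : ((forall k, cross_cos p k = 0) /\ (forall k, cross_sin p k = 0)) <->
  (forall i : 'I_13, (7 <= i)%N -> p 0 i = 0).
Proof.
split=> [[hc hs] i|p0]; last first.
  have z i : (7 <= i < 13)%N -> par p i = 0.
    by move=> /andP[i7 i13]; apply: p0; rewrite inordK.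
  split=> k; rewrite /cross_cos /cross_sin /moment2_ker !z//;
    by case: k => -[|[|[|[|[|[|//]]]]]] ? /=; ring.
have ker2 a b c : (forall k, moment2_ker a b c k = 0) -> [/\ a = 0, b = 0 & c = 0].
  move=> h; have := h (inord 2); have := h (inord 3); have := h (inord 5).
  by rewrite /moment2_ker !inordK//= => h1 h2 h3; split; lra.
have [p7 p8 p9] := ker2 _ _ _ hc; have [p10 p11 p12] := ker2 _ _ _ hs.
rewrite -[i in p 0 i]inord_val -/(par p i).
by case: i => -[|[|[|[|[|[|[|[|[|[|[|[|[|//]]]]]]]]]]]]].
Qed.

Hypothesis ST : S ^+ 2 + T ^+ 2 = 1 :> R.

(** The six entries of the identity: sum of weight times xi xi^T equals 1/3 of the identity matrix.
    The right sides 1 and 1/2 match the factors 1/3 and 2/3 carried by the axial and planar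
    coordinates; the first equation is also the sphere condition. *)
Lemma weight_moments p :
  [/\ \sum_k (weight_l p k + weight_r p k) = 1,
      \sum_k (weight_l p k - weight_r p k) * circle_x k = 0 &
      \sum_k (weight_l p k - weight_r p k) * circle_y k = 0] /\
  [/\ \sum_k (weight_l p k + weight_r p k) * circle_x k ^+ 2 = 1 / 2,
      \sum_k (weight_l p k + weight_r p k) * circle_y k ^+ 2 = 1 / 2 &
      \sum_k (weight_l p k + weight_r p k) * (circle_x k * circle_y k) = 0].
Proof.
have e1 k : weight_l p k + weight_r p k = weight_sum p k by rewrite /weight_l /weight_r; field.
have e2 k : weight_l p k - weight_r p k = weight_diff p k by rewrite /weight_l /weight_r;
  field.
split; split; under eq_bigr do rewrite ?e1 ?e2;
  rewrite !big_ord_recl big_ord0 /weight_sum /weight_diff /circle_x /circle_y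
    /moment2_ker /moment1_ker /=; [by field|by ring|by ring| | |by ring].
(* The equation holds only modulo S^2 + T^2 = 1, so this factor is exhibited explicitly. *)
- transitivity (1 / 2 + (1 / 3 + par p 0 + par p 2) * (S ^+ 2 + T ^+ 2 - 1)); first by field.
  by rewrite ST subrr mulr0 addr0.
- transitivity (1 / 2 + (1 / 3 + par p 0 + par p 2) * (S ^+ 2 + T ^+ 2 - 1)); first by field.
  by rewrite ST subrr mulr0 addr0.
Qed.

Lemma cross_moments (a b c : R) (g := moment2_ker a b c) :
  [/\ \sum_k g k = 0, \sum_k g k * circle_x k ^+ 2 = 0,
      \sum_k g k * circle_y k ^+ 2 = 0 & \sum_k g k * (circle_x k * circle_y k) = 0].
Proof.
split; rewrite !big_ord_recl big_ord0 /g /circle_x /circle_y /moment2_ker /=;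
  [by ring| | |by ring].
- transitivity ((a + c) * (S ^+ 2 + T ^+ 2 - 1)); first by ring.
  by rewrite ST subrr mulr0.
- transitivity ((a + c) * (S ^+ 2 + T ^+ 2 - 1)); first by ring.
  by rewrite ST subrr mulr0.
Qed.

(** The worst entries are the first two, where |S^2 - T^2| <= 1 gives 2e + 2e. *)
Lemma moment2_ker_le (a b c e : R) k : `|a| <= e -> `|b| <= e -> `|c| <= e ->
  `|moment2_ker a b c k| <= 4 * e.
Proof.
have h : S ^+ 2 + T ^+ 2 = 1 by exact: ST.
move=> ae be ce; have C1 : `|S ^+ 2 - T ^+ 2| <= 1.
  by have S2 := sqr_ge0 S; have T2 := sqr_ge0 T; rewrite ler_norml; apply/andP; split; lra.
have Ca : `|(S ^+ 2 - T ^+ 2) * (a - c)| <= `|a - c| by rewrite normrM ler_piMl.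
have ac : `|a - c| <= 2 * e by rewrite (le_trans (ler_normB _ _))//; lra.
have := le_trans Ca ac; move: ac ae be ce; rewrite !ler_norml.
case: k => -[|[|[|[|[|[|//]]]]]] ? /=; rewrite /moment2_ker /=;
  by move=> /andP[? ?] /andP[? ?] /andP[? ?] /andP[? ?] /andP[? ?]; lra.
Qed.

Lemma moment1_ker_le (a b c d e : R) k : `|a| <= e -> `|b| <= e -> `|c| <= e -> `|d| <= e ->
  `|moment1_ker a b c d k| <= 4 * e.
Proof.
have h : S ^+ 2 + T ^+ 2 = 1 by exact: ST.
move=> ae be ce de.
have S1 : `|S| <= 1 by rewrite -(ler_pXn2r (n := 2))// ?nnegrE// expr1n real_normK ?num_real//; have := sqr_ge0 T; lra.
have T1 : `|T| <= 1 by rewrite -(ler_pXn2r (n := 2))// ?nnegrE// expr1n real_normK ?num_real//; have := sqr_ge0 S; lra.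
have mS x : `|S * x| <= `|x| by rewrite normrM ler_piMl.
have mT x : `|T * x| <= `|x| by rewrite normrM ler_piMl.
have ab : `|a + b| <= 2 * e by rewrite (le_trans (ler_normD _ _))//; lra.
have cd : `|c + d| <= 2 * e by rewrite (le_trans (ler_normD _ _))//; lra.
have ab' : `|a - b| <= 2 * e by rewrite (le_trans (ler_normB _ _))//; lra.
have cd' : `|c - d| <= 2 * e by rewrite (le_trans (ler_normB _ _))//; lra.
have e0 : 0 <= e by rewrite (le_trans _ ae).
have h1 := le_trans (mS _) ab; have h2 := le_trans (mT _) cd.
have h3 := le_trans (mT _) ab'; have h4 := le_trans (mS _) cd'.
move: h1 h2 h3 h4 ae be ce de; rewrite !ler_norml.
case: k => -[|[|[|[|[|[|//]]]]]] ? /=; rewrite /moment1_ker /=;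
  by move=> /andP[? ?] /andP[? ?] /andP[? ?] /andP[? ?] /andP[? ?] /andP[? ?] /andP[? ?] /andP[? ?]; lra.
Qed.

(** Each kernel entry is at most 4/200 = 1/50 in size, so every weight is at least (1/6 - 2/50) / 2
    = 19/300, just above 1/16; and 16 (2/2500) is well below 19/300. This fixes the constant
    1/200. *)
Lemma weights_ge (p : 'rV[R]_13) : (forall i, `|p 0 i| < 1 / 200) ->
  (forall k, 1 / 16 <= weight_l p k) /\
  (forall k, 16 * (cross_cos p k ^+ 2 + cross_sin p k ^+ 2) <= weight_r p k).
Proof.
move=> pe; have h i : `|par p i| <= 1 / 200 by exact/ltW/pe.
have hs k := moment2_ker_le k (h 0%N) (h 1%N) (h 2%N).
have hd k := moment1_ker_le k (h 3%N) (h 4%N) (h 5%N) (h 6%N).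
have hP k := moment2_ker_le k (h 7%N) (h 8%N) (h 9%N).
have hQ k := moment2_ker_le k (h 10%N) (h 11%N) (h 12%N).
split=> k; move: (hs k) (hd k);
  rewrite /weight_l /weight_r /weight_sum /weight_diff !ler_norml.
  by move=> /andP[? ?] /andP[? ?]; lra.
have sq (x : R) : `|x| <= 4 * (1 / 200) -> x ^+ 2 <= 1 / 2500.
  by move=> x1; rewrite -real_normK ?num_real// (le_trans (lerXn2r 2 _ _ x1)) ?nnegrE//; lra.
have := sq _ (hP k); have := sq _ (hQ k); rewrite /cross_cos /cross_sin.
by move=> ? ? /andP[? ?] /andP[? ?]; lra.
Qed.

End ParameterSpace.

(** * The family of immersions *)

Section Family.
Variables (R : realType) (r : nat) (s t : int).
Hypothesis r_prime : prime r.
Hypothesis r_odd : odd r.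
Hypothesis s0 : 0 < s.
Hypothesis t0 : 0 < t.
Hypothesis st : s ^+ 2 + t ^+ 2 = r%:Z ^+ 2.

Let S : R := s%:~R / r%:R.
Let T : R := t%:~R / r%:R.
Let xi := freq R r s t.
Let sigma : R := (Num.sqrt 3)^-1.
Let tau : R := Num.sqrt (2 / 3).

Let rR0 : r%:R != 0 :> R.
Proof. by rewrite pnatr_eq0 -lt0n prime_gt0. Qed.

Lemma ST1 : S ^+ 2 + T ^+ 2 = 1.
Proof.
have := congr1 (intr : int -> R) st; rewrite rmorphD !rmorphXn /= -pmulrn => e.
by rewrite /S /T !exprMn -mulrDl e exprVn divff// expf_neq0.
Qed.

Lemma circle_xE k : (circle_point r s t k).1%:~R / r%:R = circle_x S T k.
Proof.
by rewrite /circle_point /circle_x; case: k => -[|[|[|[|[|[|//]]]]]] ? /=;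
  rewrite ?mul0r// -pmulrn divff.
Qed.

Lemma circle_yE k : (circle_point r s t k).2%:~R / r%:R = circle_y S T k.
Proof.
by rewrite /circle_point /circle_y; case: k => -[|[|[|[|[|[|//]]]]]] ? /=;
  rewrite ?mul0r// ?rmorphN ?mulNr// -pmulrn divff.
Qed.

Lemma freq_l k : xi (lshift 6 k) = vec3 sigma (tau * circle_x S T k) (tau * circle_y S T k).
Proof. by rewrite /xi /freq (unsplitK (inl k)) /unit_freq circle_xE circle_yE. Qed.

Lemma freq_r k : xi (rshift 6 k) = vec3 sigma (- (tau * circle_x S T k)) (- (tau * circle_y S T k)).
Proof.
rewrite /xi /freq (unsplitK (inr k)) /unit_freq !rmorphN /= !mulNr !mulrN.
by rewrite circle_xE circle_yE.
Qed.

(** The common sum xi_w + xi_(-w): the planar parts cancel. *)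
Let base : 'rV[R]_3 := vec3 (2 * sigma) 0 0.

Lemma phase_lr k u : phase base u = phase (xi (lshift 6 k)) u + phase (xi (rshift 6 k)) u.
Proof. by rewrite freq_l freq_r /phase !dot3 /base !vec3E; ring. Qed.

Variable p : 'rV[R]_13.

Let a := cos_coef (weight_l S T p) (weight_r S T p) (cross_cos S T p) (cross_sin S T p).
Let b := sin_coef (weight_l S T p) (weight_r S T p) (cross_cos S T p) (cross_sin S T p).
Let G := coef_comb (weight_l S T p) (weight_r S T p) (cross_cos S T p) (cross_sin S T p).

Definition torus_map : 'rV[R]_3 -> 'rV[R]_(35.+1) := trig xi a b.

Let c j u := cos (phase (xi j) u).
Let z j u := sin (phase (xi j) u).

Lemma partial_torus_map i u : partial torus_map i u =
  G (fun j => - (2 * pi * xi j 0 i * z j u)) (fun j => 2 * pi * xi j 0 i * c j u).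
Proof.
rewrite /partial /torus_map derive_trigE /trig /G /coef_comb; apply: eq_bigr => j _.
rewrite /phase dot_delta addrC !scalerA -/(a j) -/(b j).
by congr (_ *: _ + _ *: _); rewrite /c /z /phase; ring.
Qed.

Hypothesis p_small : forall i, `|p 0 i| < 1 / 200.

Let al_ge := (weights_ge ST1 p_small).1.
Let be_ge := (weights_ge ST1 p_small).2.

Let cs1 k u : c k u ^+ 2 + z k u ^+ 2 = 1.
Proof. exact: cos2Dsin2. Qed.

Let cos_base k u : c (lshift 6 k) u * c (rshift 6 k) u - z (lshift 6 k) u * z (rshift 6 k) u =
  cos (phase base u).
Proof. by rewrite (phase_lr k) cosD. Qed.

Let sin_base k u : c (lshift 6 k) u * z (rshift 6 k) u + z (lshift 6 k) u * c (rshift 6 k) u =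
  sin (phase base u).
Proof. by rewrite (phase_lr k) sinD addrC. Qed.

(** The squares contribute the total weight 1. The cross terms of all pairs share the factors cos
    and sin of the phase of [base], and cancel because P and Q have sum zero. *)
Lemma torus_map_sphere : in_unit_sphere torus_map.
Proof.
move=> u; have -> : torus_map u = G (c^~ u) (z^~ u) by [].
have [[w1 _ _] _] := weight_moments ST1 p.
have [m1 _ _ _] := cross_moments ST1 (par p 7) (par p 8) (par p 9).
have [n1 _ _ _] := cross_moments ST1 (par p 10) (par p 11) (par p 12).
rewrite /G dot_coef_comb; [|exact: al_ge|exact: be_ge].
transitivity (\sum_k (weight_l S T p k + weight_r S T p k) +
  2 * cos (phase base u) * \sum_k cross_cos S T p k +
  2 * sin (phase base u) * \sum_k cross_sin S T p k).
  rewrite !mulr_sumr -!big_split /=; apply: eq_bigr => k _.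
  transitivity (weight_l S T p k * (c (lshift 6 k) u ^+ 2 + z (lshift 6 k) u ^+ 2) +
    weight_r S T p k * (c (rshift 6 k) u ^+ 2 + z (rshift 6 k) u ^+ 2) +
    cross_cos S T p k * 2 *
      (c (lshift 6 k) u * c (rshift 6 k) u - z (lshift 6 k) u * z (rshift 6 k) u) +
    cross_sin S T p k * 2 *
      (c (lshift 6 k) u * z (rshift 6 k) u + z (lshift 6 k) u * c (rshift 6 k) u)).
    by ring.
  by rewrite !cs1 cos_base sin_base; ring.
by rewrite w1 m1 n1 !mulr0 !addr0.
Qed.

Lemma weight_form i j : \sum_k (weight_l S T p k * (xi (lshift 6 k) 0 i * xi (lshift 6 k) 0 j) +
    weight_r S T p k * (xi (rshift 6 k) 0 i * xi (rshift 6 k) 0 j)) = 3^-1 *+ (i == j).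
Proof.
have [[w1 w2 w3] [w4 w5 w6]] := weight_moments ST1 p.
have s2 : sigma * sigma = 3^-1 by rewrite -expr2; exact: sqr_sqrt3V.
have t2 : tau * tau = 2 / 3 by rewrite -expr2; exact: sqr_sqrt23.
have fl k l : xi (lshift 6 k) 0 l = vec3 sigma (tau * circle_x S T k) (tau * circle_y S T k) 0 l.
  by rewrite freq_l.
have fr k l : xi (rshift 6 k) 0 l =
    vec3 sigma (- (tau * circle_x S T k)) (- (tau * circle_y S T k)) 0 l by rewrite freq_r.
case: (ord3P i) => ->; case: (ord3P j) => ->.
- transitivity ((sigma * sigma) * \sum_k (weight_l S T p k + weight_r S T p k));
    last by rewrite s2 w1 mulr1n; field.
  by rewrite mulr_sumr; apply: eq_bigr => k _; rewrite !(fl, fr) !vec3E; ring.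
- transitivity ((sigma * tau) * \sum_k (weight_l S T p k - weight_r S T p k) * circle_x S T k);
    last by rewrite w2 mulr0.
  by rewrite mulr_sumr; apply: eq_bigr => k _; rewrite !(fl, fr) !vec3E; ring.
- transitivity ((sigma * tau) * \sum_k (weight_l S T p k - weight_r S T p k) * circle_y S T k);
    last by rewrite w3 mulr0.
  by rewrite mulr_sumr; apply: eq_bigr => k _; rewrite !(fl, fr) !vec3E; ring.
- transitivity ((sigma * tau) * \sum_k (weight_l S T p k - weight_r S T p k) * circle_x S T k);
    last by rewrite w2 mulr0.
  by rewrite mulr_sumr; apply: eq_bigr => k _; rewrite !(fl, fr) !vec3E; ring.
- transitivity ((tau * tau) * \sum_k (weight_l S T p k + weight_r S T p k) * circle_x S T k ^+ 2); last by rewrite t2 w4 mulr1n; field.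
  by rewrite mulr_sumr; apply: eq_bigr => k _; rewrite !(fl, fr) !vec3E; ring.
- transitivity ((tau * tau) * \sum_k (weight_l S T p k + weight_r S T p k) * (circle_x S T k * circle_y S T k)); last by rewrite w6 mulr0.
  by rewrite mulr_sumr; apply: eq_bigr => k _; rewrite !(fl, fr) !vec3E; ring.
- transitivity ((sigma * tau) * \sum_k (weight_l S T p k - weight_r S T p k) * circle_y S T k);
    last by rewrite w3 mulr0.
  by rewrite mulr_sumr; apply: eq_bigr => k _; rewrite !(fl, fr) !vec3E; ring.
- transitivity ((tau * tau) * \sum_k (weight_l S T p k + weight_r S T p k) * (circle_x S T k * circle_y S T k)); last by rewrite w6 mulr0.
  by rewrite mulr_sumr; apply: eq_bigr => k _; rewrite !(fl, fr) !vec3E; ring.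
- transitivity ((tau * tau) * \sum_k (weight_l S T p k + weight_r S T p k) * circle_y S T k ^+ 2); last by rewrite t2 w5 mulr1n; field.
  by rewrite mulr_sumr; apply: eq_bigr => k _; rewrite !(fl, fr) !vec3E; ring.
Qed.

(** Axial-planar entries vanish identically, the planar parts being opposite; the others are
    multiples of the moments of g of orders zero and two. *)
Lemma cross_form (g0 g1 g2 : R) i j (g := moment2_ker S T g0 g1 g2) :
  \sum_k g k * (xi (lshift 6 k) 0 i * xi (rshift 6 k) 0 j + xi (rshift 6 k) 0 i * xi (lshift 6 k) 0 j) = 0.
Proof.
have [m1 m2 m3 m4] := cross_moments ST1 g0 g1 g2.
have fl k l : xi (lshift 6 k) 0 l = vec3 sigma (tau * circle_x S T k) (tau * circle_y S T k) 0 l.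
  by rewrite freq_l.
have fr k l : xi (rshift 6 k) 0 l =
    vec3 sigma (- (tau * circle_x S T k)) (- (tau * circle_y S T k)) 0 l by rewrite freq_r.
case: (ord3P i) => ->; case: (ord3P j) => ->.
- transitivity ((2 * sigma ^+ 2) * \sum_k g k); last by rewrite m1 mulr0.
  by rewrite mulr_sumr; apply: eq_bigr => k _; rewrite !(fl, fr) !vec3E; ring.
- transitivity ((0) * \sum_k g k); last by rewrite m1 mulr0.
  by rewrite mulr_sumr; apply: eq_bigr => k _; rewrite !(fl, fr) !vec3E; ring.
- transitivity ((0) * \sum_k g k); last by rewrite m1 mulr0.
  by rewrite mulr_sumr; apply: eq_bigr => k _; rewrite !(fl, fr) !vec3E; ring.
- transitivity ((0) * \sum_k g k); last by rewrite m1 mulr0.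
  by rewrite mulr_sumr; apply: eq_bigr => k _; rewrite !(fl, fr) !vec3E; ring.
- transitivity ((- 2 * tau ^+ 2) * \sum_k g k * circle_x S T k ^+ 2); last by rewrite m2 mulr0.
  by rewrite mulr_sumr; apply: eq_bigr => k _; rewrite !(fl, fr) !vec3E; ring.
- transitivity ((- 2 * tau ^+ 2) * \sum_k g k * (circle_x S T k * circle_y S T k));
    last by rewrite m4 mulr0.
  by rewrite mulr_sumr; apply: eq_bigr => k _; rewrite !(fl, fr) !vec3E; ring.
- transitivity ((0) * \sum_k g k); last by rewrite m1 mulr0.
  by rewrite mulr_sumr; apply: eq_bigr => k _; rewrite !(fl, fr) !vec3E; ring.
- transitivity ((- 2 * tau ^+ 2) * \sum_k g k * (circle_x S T k * circle_y S T k));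
    last by rewrite m4 mulr0.
  by rewrite mulr_sumr; apply: eq_bigr => k _; rewrite !(fl, fr) !vec3E; ring.
- transitivity ((- 2 * tau ^+ 2) * \sum_k g k * circle_y S T k ^+ 2); last by rewrite m3 mulr0.
  by rewrite mulr_sumr; apply: eq_bigr => k _; rewrite !(fl, fr) !vec3E; ring.
Qed.

(** Same cancellation as on the sphere: differentiation turns (cos, sin) into (-sin, cos), which
    changes the sign of the cross terms and weights them by symmetrized products of frequency
    coordinates. *)
Lemma torus_map_isometric : isometric_for (4 * pi ^+ 2 / 3) torus_map.
Proof.
move=> u; apply/matrixP => i j; rewrite !mxE !partial_torus_map.
rewrite /G dot_coef_comb; [|exact: al_ge|exact: be_ge].
transitivity ((2 * pi) ^+ 2 * \sum_k (weight_l S T p k * (xi (lshift 6 k) 0 i * xi (lshift 6 k) 0 j) +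
    weight_r S T p k * (xi (rshift 6 k) 0 i * xi (rshift 6 k) 0 j)) -
  (2 * pi) ^+ 2 * cos (phase base u) * (\sum_k cross_cos S T p k *
    (xi (lshift 6 k) 0 i * xi (rshift 6 k) 0 j + xi (rshift 6 k) 0 i * xi (lshift 6 k) 0 j)) -
  (2 * pi) ^+ 2 * sin (phase base u) * (\sum_k cross_sin S T p k *
    (xi (lshift 6 k) 0 i * xi (rshift 6 k) 0 j + xi (rshift 6 k) 0 i * xi (lshift 6 k) 0 j))).
  rewrite !mulr_sumr -!sumrB /=; apply: eq_bigr => k _.
  transitivity ((2 * pi) ^+ 2 * (
    weight_l S T p k * (xi (lshift 6 k) 0 i * xi (lshift 6 k) 0 j) *
      (c (lshift 6 k) u ^+ 2 + z (lshift 6 k) u ^+ 2) +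
    weight_r S T p k * (xi (rshift 6 k) 0 i * xi (rshift 6 k) 0 j) *
      (c (rshift 6 k) u ^+ 2 + z (rshift 6 k) u ^+ 2) -
    (xi (lshift 6 k) 0 i * xi (rshift 6 k) 0 j + xi (rshift 6 k) 0 i * xi (lshift 6 k) 0 j) *
    (cross_cos S T p k *
      (c (lshift 6 k) u * c (rshift 6 k) u - z (lshift 6 k) u * z (rshift 6 k) u) +
     cross_sin S T p k *
      (c (lshift 6 k) u * z (rshift 6 k) u + z (lshift 6 k) u * c (rshift 6 k) u)))).
    by ring.
  by rewrite !cs1 cos_base sin_base; ring.
rewrite weight_form !cross_form !mulr0 !subr0.
by case: eqP => _; rewrite ?mulr1n ?mulr0n ?mulr0//; field.
Qed.

Lemma freq_unit j : dot (xi j) (xi j) = 1.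
Proof.
have [b' [c' [jE bc]]] := freq_unit_freq R r_prime r_odd s0 t0 st j; rewrite /xi jE.
exact: unit_freq_norm.
Qed.

Lemma freq_lattice j : lattice_star r (xi j).
Proof.
have [b' [c' [jE bc]]] := freq_unit_freq R r_prime r_odd s0 t0 st j; rewrite /xi jE.
by have [] := lattice_star_unit_freq R r_prime r_odd s0 t0 st bc.
Qed.

Lemma torus_map_immersion :
  minimal_isometric_immersion (dual_lattice (lattice_star (R := R) r)) (4 * pi ^+ 2 / 3) torus_map.
Proof.
split.
- exact: smooth_trig.
- by move=> u v vL; apply: trig_periodic => j; apply/vL/freq_lattice.
- exact: torus_map_sphere.
- exact: torus_map_isometric.
- apply: (minimal_trig freq_unit _ torus_map_isometric).
  by rewrite !mulf_neq0 ?invr_neq0 ?expf_neq0 ?gt_eqF ?pi_gt0 ?ltr0n.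
Qed.

End Family.

(** * Congruence and homogeneity read off the coefficients *)

Lemma dot_mulmx (R : realType) (n m : nat) (Q : 'M[R]_(n, m)) (u v : 'rV[R]_n) :
  Q *m Q^T = 1%:M -> dot (u *m Q) (v *m Q) = dot u v.
Proof.
have dE k (x y : 'rV[R]_k) : dot x y = (x *m y^T) 0 0.
  by rewrite mxE; apply: eq_bigr => i _; rewrite mxE.
by move=> QQ; rewrite !dE trmx_mul mulmxA -(mulmxA u) QQ mulmx1.
Qed.

Lemma trig_inj (R : realType) (n m N : nat) (xi : 'I_N -> 'rV[R]_n.+1)
    (a b a' b' : 'I_N -> 'rV[R]_m.+1) :
  (forall j, dot (xi j) (xi j) = 1) ->
  (forall i j, xi i = xi j \/ xi i = - xi j -> i = j) ->
  (forall u, trig xi a b u = trig xi a' b' u) -> forall j, a j = a' j /\ b j = b' j.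
Proof.
move=> xi1 xid e j.
have [] := @trig_free _ _ _ _ xi xi1 xid (fun j => a j - a' j) (fun j => b j - b' j) _ j.
  move=> u; have /eqP := e u; rewrite -subr_eq0 => /eqP <-.
  rewrite /trig -sumrB; apply: eq_bigr => i _.
  by rewrite !scalerBr opprD addrACA.
by move=> /eqP + /eqP; rewrite !subr_eq0 => /eqP -> /eqP ->.
Qed.

Lemma trig_mulmx (R : realType) (n m q N : nat) (xi : 'I_N -> 'rV[R]_n.+1)
    (a b : 'I_N -> 'rV[R]_m.+1) (Q : 'M[R]_(m.+1, q.+1)) u :
  trig xi a b u *m Q = trig xi (fun j => a j *m Q) (fun j => b j *m Q) u.
Proof.
rewrite /trig mulmx_suml; apply: eq_bigr => j _.
by rewrite mulmxDl -!scalemxAl.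
Qed.

(** By uniqueness of the coefficients, the orthogonal matrix Q maps those of one map to those of the
    other, and Q preserves inner products. *)
Lemma congruent_trig (R : realType) (n m N : nat) (xi : 'I_N -> 'rV[R]_n.+1)
    (a b a' b' : 'I_N -> 'rV[R]_m.+1) :
  (forall j, dot (xi j) (xi j) = 1) ->
  (forall i j, xi i = xi j \/ xi i = - xi j -> i = j) ->
  congruent (trig xi a b) (trig xi a' b') ->
  forall i j, dot (a' i) (a' j) = dot (a i) (a j) /\ dot (a' i) (b' j) = dot (a i) (b j).
Proof.
move=> xi1 xid [Q [QQ e]] i j.
have h := @trig_inj _ _ _ _ xi a' b' (fun j => a j *m Q) (fun j => b j *m Q) xi1 xid.
have {}h := h (fun u => etrans (e u) (trig_mulmx xi a b Q u)).
by rewrite (h i).1 (h j).1 (h j).2 !dot_mulmx.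
Qed.

Lemma mulmx_trmx_dot (R : realType) (n m : nat) (A : 'M[R]_(n, m)) i j :
  (A *m A^T) i j = dot (row i A) (row j A).
Proof. by rewrite mxE; apply: eq_bigr => k _; rewrite !mxE. Qed.

Lemma mxvec_index_inj (n m : nat) (i i' : 'I_n) (j j' : 'I_m) :
  mxvec_index i j = mxvec_index i' j' -> i = i' /\ j = j'.
Proof. by move=> /cast_ord_inj/enum_rank_inj[]. Qed.

(** The enumeration and the matrix in [homogeneous] are arbitrary. Another enumeration changes
    numbering and signs only; a sign flips a sine row, so orthogonality of the rows passes to a and
    b. *)
Lemma homogeneous_trig (R : realType) (n m N : nat) (L : set 'rV[R]_n.+1)
    (xi : 'I_N -> 'rV[R]_n.+1) (a b : 'I_N -> 'rV[R]_m.+1) :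
  unit_vectors_up_to_sign L xi ->
  homogeneous L (trig xi a b) <->
  (forall i j, [/\ i != j -> dot (a i) (a j) = 0, i != j -> dot (b i) (b j) = 0,
                   dot (a i) (b j) = 0 & dot (b i) (a j) = 0]).
Proof.
move=> [xiL xid]; split; last first.
  move=> orth; exists N, xi, (rows_mx a b); split=> //.
    by move=> u; rewrite mulmx_Theta_rows_mx.
  apply/is_diag_mxP => k l; case/mxvec_indexP: k => i c; case/mxvec_indexP: l => j d kl.
  have ne : ~ (i = j /\ c = d) by move=> [e1 e2]; rewrite e1 e2 eqxx in kl.
  have [h1 h2 h3 h4] := orth i j.
  rewrite mulmx_trmx_dot !row_rows_mx.
  case: (eqVneq c 0) ne {kl} => [->|c0]; case: (eqVneq d 0) => [->|d0] kl //.
    by apply: h1; apply/eqP => ij; apply: kl.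
  apply: h2; apply/eqP => ij; apply: kl; split=> //.
  by move: c d c0 d0 => -[[|[|//]] ?] [[|[|//]] ?] // _ _; apply: val_inj.
case=> N' [xi' [A [[xiL' xid'] fE diagA]]] i j.
have xi1 k : dot (xi k) (xi k) = 1 by have [] :=
  (xiL (xi k)).2 (ex_intro _ k (or_introl erefl)).
have tau k : exists jb : 'I_N * bool, xi' k = (-1) ^+ jb.2 *: xi jb.1.
  have [l [e|e]] := (xiL (xi' k)).1 ((xiL' (xi' k)).2 (ex_intro _ k (or_introl erefl))).
    by exists (l, false); rewrite expr0 scale1r.
  by exists (l, true); rewrite expr1 scaleN1r.
have [jb jbE] := choice tau.
pose a' k := row (mxvec_index k 0) A; pose b' k := row (mxvec_index k 1) A.
have dA k c l d : (k, c) <> (l, d) -> dot (row (mxvec_index k c) A) (row (mxvec_index l d) A) = 0.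
  move=> ne; rewrite -mulmx_trmx_dot; move/is_diag_mxP: diagA; apply.
  by apply/eqP => /val_inj /mxvec_index_inj [e1 e2]; apply: ne; rewrite e1 e2.
(* Summing over all k with xi' k equal to xi j0 up to sign avoids a bijection between the
   numberings: the fibres over distinct indices are disjoint, which is enough for orthogonality. *)
have ab j0 : a j0 = \sum_(k | (jb k).1 == j0) a' k /\
    b j0 = \sum_(k | (jb k).1 == j0) (-1) ^+ (jb k).2 *: b' k.
  apply: (@trig_inj _ _ _ _ xi a b (fun j0 => \sum_(k | (jb k).1 == j0) a' k)
    (fun j0 => \sum_(k | (jb k).1 == j0) (-1) ^+ (jb k).2 *: b' k) xi1 xid) => u.
  rewrite fE mulmx_Theta /trig.
  rewrite (partition_big (fun k => (jb k).1) xpredT)//=; apply: eq_bigr => l _.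
  rewrite !scaler_sumr -big_split /=; apply: eq_bigr => k /eqP kl.
  rewrite jbE kl; case: (jb k).2; rewrite ?expr1 ?expr0 ?scaleN1r ?scale1r//.
  by rewrite phaseNl cosN sinN scaleNr scalerN.
have [ai bi] := ab i; have [aj bj] := ab j.
split=> [ij|ij||]; rewrite ?ai ?bi ?aj ?bj dot_suml big1// => k /eqP kE;
  rewrite ?dotZl dot_sumr big1 ?mulr0// => l /eqP lE; rewrite ?dotZr dA ?mulr0//.
- by case=> kl; move: ij; rewrite -kE -lE kl eqxx.
- by case=> kl; move: ij; rewrite -kE -lE kl eqxx.
Qed.

(** * Continuity of the coefficients in the parameters *)

Section ParameterContinuity.
Variables (R : realType) (S T : R).

Let real_continuous (f : 'rV[R]_13 -> R) := continuous f.

Lemma continuous_fun_cst (x : R) : real_continuous (fun=> x).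
Proof. exact: cst_continuous. Qed.

Lemma continuous_par i : real_continuous (fun p => par p i).
Proof. exact: coord_continuous. Qed.

Lemma continuous_funD f g : real_continuous f -> real_continuous g ->
  real_continuous (fun p => f p + g p).
Proof. by move=> cf cg p; exact: (continuousD (cf p) (cg p)). Qed.

Lemma continuous_funN f : real_continuous f -> real_continuous (fun p => - f p).
Proof. by move=> cf p; exact: (continuousN (cf p)). Qed.

Lemma continuous_funM f g : real_continuous f -> real_continuous g ->
  real_continuous (fun p => f p * g p).
Proof. by move=> cf cg p; exact: (continuousM (cf p) (cg p)). Qed.

Lemma continuous_funX n f : real_continuous f -> real_continuous (fun p => f p ^+ n).
Proof.
move=> cf; elim: n => [|n IH]; first exact: continuous_fun_cst.
rewrite (_ : (fun p => _) = fun p => f p * f p ^+ n); first exact: continuous_funM.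
by apply/funext => p; rewrite exprS.
Qed.

Lemma continuous_fun_sqrt f : real_continuous f -> real_continuous (fun p => Num.sqrt (f p)).
Proof. by move=> cf p; exact: (continuous_comp (cf p) (@sqrt_continuous R (f p))). Qed.

Ltac cts leaf := lazymatch goal with
  | |- real_continuous (fun _ => ?x) => exact: continuous_fun_cst
  | |- real_continuous (fun p => @?f p + @?g p) => apply: (@continuous_funD f g); cts leaf
  | |- real_continuous (fun p => - @?f p) => apply: (@continuous_funN f); cts leaf
  | |- real_continuous (fun p => @?f p * @?g p) => apply: (@continuous_funM f g); cts leaf
  | |- real_continuous (fun p => @?f p ^+ ?n) => apply: (@continuous_funX n f); cts leaf
  | |- real_continuous (fun p => Num.sqrt (@?f p)) => apply: (@continuous_fun_sqrt f); cts leaf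
  | |- _ => leaf
  end.

Lemma continuous_moment2_ker i j l k :
  real_continuous (fun p => moment2_ker S T (par p i) (par p j) (par p l) k).
Proof. by rewrite /moment2_ker; case: k => -[|[|[|[|[|[|//]]]]]] ? /=;
  cts ltac:(exact: continuous_par). Qed.

Lemma continuous_moment1_ker i j l h k :
  real_continuous (fun p => moment1_ker S T (par p i) (par p j) (par p l) (par p h) k).
Proof. by rewrite /moment1_ker; case: k => -[|[|[|[|[|[|//]]]]]] ? /=;
  cts ltac:(exact: continuous_par). Qed.

Lemma continuous_weight_l k : real_continuous (fun p => weight_l S T p k).
Proof.
apply: continuous_funM; last exact: continuous_fun_cst.
by apply: continuous_funD; [apply: continuous_funD;
  [exact: continuous_fun_cst|exact: continuous_moment2_ker]|exact: continuous_moment1_ker].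
Qed.

Lemma continuous_weight_r k : real_continuous (fun p => weight_r S T p k).
Proof.
apply: continuous_funM; last exact: continuous_fun_cst.
apply: continuous_funD; [apply: continuous_funD;
  [exact: continuous_fun_cst|exact: continuous_moment2_ker]|].
by apply: continuous_funN; exact: continuous_moment1_ker.
Qed.

Lemma continuous_cos_coef j : continuous (fun p : 'rV[R]_13 =>
  cos_coef (weight_l S T p) (weight_r S T p) (cross_cos S T p) (cross_sin S T p) j).
Proof.
have cl := continuous_weight_l; have cr := continuous_weight_r.
have cc k : real_continuous (fun p => cross_cos S T p k) by exact: continuous_moment2_ker.
have cs k : real_continuous (fun p => cross_sin S T p k) by exact: continuous_moment2_ker.
rewrite /cos_coef; case: (fintype.split j) => k; apply: continuous_block_vec;
  case=> [|[|[|[|[|[|//]]]]]] _ /=; rewrite -/(real_continuous _);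
  cts ltac:(first [exact: cc | exact: cs | exact: cl | exact: cr]).
Qed.

Lemma continuous_sin_coef j : continuous (fun p : 'rV[R]_13 =>
  sin_coef (weight_l S T p) (weight_r S T p) (cross_cos S T p) (cross_sin S T p) j).
Proof.
have cl := continuous_weight_l; have cr := continuous_weight_r.
have cc k : real_continuous (fun p => cross_cos S T p k) by exact: continuous_moment2_ker.
have cs k : real_continuous (fun p => cross_sin S T p k) by exact: continuous_moment2_ker.
rewrite /sin_coef; case: (fintype.split j) => k; apply: continuous_block_vec;
  case=> [|[|[|[|[|[|//]]]]]] _ /=; rewrite -/(real_continuous _);
  cts ltac:(first [exact: cc | exact: cs | exact: cl | exact: cr]).
Qed.

End ParameterContinuity.

Theorem proposition5p4 (R : realType) (r : nat)
    (r_prime : prime r) (r_mod4 : r = 1 %[mod 4]) :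
  exists (P : set 'rV[R]_13) (m : nat)
         (x : 'rV[R]_13 -> 'rV[R]_3 -> 'rV[R]_m.+1),
    [/\ P° !=set0,
        {within P `*` setT, continuous (fun pu : 'rV[R]_13 * 'rV[R]_3 => x pu.1 pu.2)},
        forall p, P p ->
          minimal_isometric_immersion (dual_lattice (lattice_star (R := R) r))
            (4 * pi ^+ 2 / 3) (x p),
        forall p q, P p -> P q -> p <> q -> ~ congruent (x p) (x q)
      & hausdorff_dim [set p | P p /\ homogeneous (lattice_star (R := R) r) (x p)]
          = 7%:E ].
Proof.
have [s [t [s0 t0 st]]] := pythagorean_leg r_prime r_mod4.
have r_odd : odd r by have /(congr1 odd) := divn_eq r 4; rewrite r_mod4; lia.
have S1 : (s%:~R / r%:R) ^+ 2 + (t%:~R / r%:R) ^+ 2 = 1 :> R by exact: ST1.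
(* An open cube around the uniform weights, small enough for [weights_ge]. *)
pose P : set 'rV[R]_13 := [set p | forall i, `|p 0 i| < 1 / 200].
have fu := freq_unit R r_prime r_odd s0 t0 st.
have fv := freq_unit_vectors R r_prime r_odd s0 t0 st.
exists P, 35%N, (torus_map r s t); split.
- exists 0; apply/nbhs_ballP; exists (1 / 200); first by rewrite /= divr_gt0// ltr0n.
  move=> p; rewrite mx_norm_ball /ball_ /= sub0r normrN => pn i.
  exact: le_lt_trans (ler_coord_norm p 0 i) pn.
- apply: continuous_subspaceT.
  pose S : R := s%:~R / r%:R; pose T : R := t%:~R / r%:R.
  exact: (@continuous_trig _ _ _ _ _ (freq R r s t)
    (fun p => cos_coef (weight_l S T p) (weight_r S T p) (cross_cos S T p) (cross_sin S T p))
    (fun p => sin_coef (weight_l S T p) (weight_r S T p) (cross_cos S T p) (cross_sin S T p))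
    (@continuous_cos_coef R S T) (@continuous_sin_coef R S T)).
- by move=> p Pp; apply: torus_map_immersion.
- move=> p q Pp Pq pq cpq; apply: pq.
  have h := congruent_trig fu fv.2 cpq.
  have [lp rp] := weights_ge S1 Pp; have [lq rq] := weights_ge S1 Pq.
  (* The Gram entries inside each pair are the weights and correlations, which recover all thirteen
     parameters. *)
  apply: (@parameters_inj _ (s%:~R / r%:R) (t%:~R / r%:R)) => k.
  + by have := (h (lshift 6 k) (lshift 6 k)).1; rewrite !dot_cos_coef_l.
  + by have := (h (rshift 6 k) (rshift 6 k)).1; rewrite !dot_cos_coef_r.
  + by have := (h (lshift 6 k) (rshift 6 k)).1; rewrite !dot_cos_coef_lr.
  + by have := (h (lshift 6 k) (rshift 6 k)).2; rewrite !dot_cos_sin_coef_lr.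
(* Homogeneity means that all correlations vanish, that is, the last six coordinates are zero; the
   first seven stay free in the cube. *)
rewrite (_ : [set p | _] = flat_cube 7 (1 / 200)).
  by rewrite hausdorff_dim_flat_cube// divr_gt0// ltr0n.
apply/seteqP; split=> p /= [Pp hp]; split=> //.
  move: hp => /(homogeneous_trig _ _ fv) hp; have [lp rp] := weights_ge S1 Pp.
  apply/(cross_eq0P (s%:~R / r%:R) (t%:~R / r%:R)); split=> k.
    have [h1 _ _ _] := hp (lshift 6 k) (rshift 6 k).
    by move: h1; rewrite dot_cos_coef_lr// eq_lrshift; apply.
  have [_ _ h3 _] := hp (lshift 6 k) (rshift 6 k).
  by move: h3; rewrite dot_cos_sin_coef_lr.
have [lp rp] := weights_ge S1 Pp.
apply/(homogeneous_trig _ _ fv) => i j.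
have [hc hs] := (cross_eq0P (s%:~R / r%:R) (t%:~R / r%:R) p).2 hp.
by have [h1 h2 h3 h4] := coef_orthogonal lp rp i j hc hs; split.
Qed.
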